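(* Let $X_1\subset X_2\subset\cdots$ be an increasing sequence of finite-dimensional Banach spaces (each $X_n$ a subspace of $X_{n+1}$ with the induced norm) with $\dim X_n\to\infty$. Then there exists an infinite connected unweighted graph $G$ (with its shortest path metric) such that for every Banach space $X$ the following are equivalent: (a) $G$ admits a bilipschitz embedding into $X$; (b) the spaces $\{X_n\}_{n=1}^\infty$ admit uniformly isomorphic embeddings into $X$.
   Context: Graphs carry the shortest path metric. Linear embeddings $T_n:X_n\to X$ are uniformly isomorphic if $\sup_n\|T_n\|\cdot\|T_n^{-1}|_{T_n(X_n)}\|<\infty$. A bilipschitz embedding is a map $f$ with $r d(u,v)\le d(f(u),f(v))\le rC d(u,v)$ for some $r>0$, $C<\infty$ and all $u,v$. *)

(* Defs.v *)
From Stdlib Require Import Reals List.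
Open Scope R_scope.

Record NormedSpace := {
  carrier :> Type;
  vzero : carrier;
  vadd : carrier -> carrier -> carrier;
  vopp : carrier -> carrier;
  vscal : R -> carrier -> carrier;
  vnorm : carrier -> R;
  vadd_assoc : forall x y z, vadd x (vadd y z) = vadd (vadd x y) z;
  vadd_comm : forall x y, vadd x y = vadd y x;
  vadd_zero : forall x, vadd x vzero = x;
  vadd_opp : forall x, vadd x (vopp x) = vzero;
  vscal_one : forall x, vscal 1 x = x;
  vscal_assoc : forall a b x, vscal a (vscal b x) = vscal (a * b) x;
  vscal_distr_v : forall a x y, vscal a (vadd x y) = vadd (vscal a x) (vscal a y);
  vscal_distr_s : forall a b x, vscal (a + b) x = vadd (vscal a x) (vscal b x);
  vnorm_zero : forall x, vnorm x = 0 -> x = vzero;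
  vnorm_scal : forall a x, vnorm (vscal a x) = Rabs a * vnorm x;
  vnorm_triangle : forall x y, vnorm (vadd x y) <= vnorm x + vnorm y
}.

Arguments vzero {n}.
Arguments vadd {n}.
Arguments vopp {n}.
Arguments vscal {n}.
Arguments vnorm {n}.

Definition vsub {X : NormedSpace} (x y : X) : X := vadd x (vopp y).

Definition banach (X : NormedSpace) : Prop :=
  forall x : nat -> X,
    (forall eps, 0 < eps -> exists N, forall m n, (N <= m)%nat -> (N <= n)%nat ->
        vnorm (vsub (x m) (x n)) < eps) ->
    exists l : X, forall eps, 0 < eps -> exists N, forall n, (N <= n)%nat ->
        vnorm (vsub (x n) l) < eps.

Fixpoint lincomb {E : NormedSpace} (cs : list R) (vs : list E) : E :=
  match cs, vs with
  | c :: cs', v :: vs' => vadd (vscal c v) (lincomb cs' vs')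
  | _, _ => vzero
  end.

Definition lin_indep {E : NormedSpace} (vs : list E) : Prop :=
  forall cs, length cs = length vs -> lincomb cs vs = vzero -> Forall (fun c => c = 0) cs.

Definition has_dim {E : NormedSpace} (V : E -> Prop) (d : nat) : Prop :=
  exists vs : list E, length vs = d /\ lin_indep vs /\
    (forall x, V x <-> exists cs, length cs = length vs /\ x = lincomb cs vs).

(** Uniformly isomorphic linear embeddings of the subspaces [Xs n] of [E] into [X]:
    there is K such that every Xs n admits a linear T_n with ||T_n|| ||T_n^{-1}|| <= K,
    written out as  c ||x|| <= ||T_n x|| <= c K ||x||  on Xs n (c = 1/||T_n^{-1}||). *)
Definition linear_on {E X : NormedSpace} (V : E -> Prop) (T : E -> X) : Prop :=
  (forall x y, V x -> V y -> T (vadd x y) = vadd (T x) (T y)) /\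
  (forall a x, V x -> T (vscal a x) = vscal a (T x)).

Definition unif_iso_embeds (E : NormedSpace) (Xs : nat -> E -> Prop) (X : NormedSpace) : Prop :=
  exists K : R, forall n : nat, exists (T : E -> X) (c : R),
    linear_on (Xs n) T /\ 0 < c /\
    forall x, Xs n x -> c * vnorm x <= vnorm (T x) <= c * K * vnorm x.

Inductive walk {V : Type} (adj : V -> V -> Prop) : V -> V -> nat -> Prop :=
  | walk0 : forall v, walk adj v v 0
  | walkS : forall u w v n, adj u w -> walk adj w v n -> walk adj u v (S n).

Definition gdist {V : Type} (adj : V -> V -> Prop) (u v : V) (n : nat) : Prop :=
  walk adj u v n /\ forall m, walk adj u v m -> (n <= m)%nat.

Definition simple_graph {V : Type} (adj : V -> V -> Prop) : Prop :=
  (forall u v, adj u v -> adj v u) /\ (forall v, ~ adj v v).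

Definition connected {V : Type} (adj : V -> V -> Prop) : Prop :=
  forall u v, exists n, walk adj u v n.

Definition infinite_type (V : Type) : Prop :=
  ~ exists l : list V, forall v, In v l.

Definition bilip_embeds {V : Type} (adj : V -> V -> Prop) (X : NormedSpace) : Prop :=
  exists (f : V -> X) (r C : R), 0 < r /\
    forall u v n, gdist adj u v n ->
      r * INR n <= vnorm (vsub (f u) (f v)) <= r * C * INR n.

(* Main.v *)
Require Import Defs.
From Stdlib Require Import Reals List Lra Lia Psatz ZArith.
From Stdlib Require Import ClassicalEpsilon FunctionalExtensionality PropExtensionality ProofIrrelevance.
Open Scope R_scope.

(** [G] is a ray carrying at position [q^2] a net of the ball of radius [q] of [X_(q^2)], two
    points of a net being adjacent when they are at distance at most 3.

    If the [X_n] embed uniformly into [X], fix a unit vector [e] of [X] and place the net at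
    position [t] around [A t e], using an embedding whose image is transversal to [e]. The distance
    between two balls dominates their radii, so a large [A] separates their images.

    Conversely, let [F] be a coarse embedding of a large ball of [X_k] into [X] and let [l] be a
    finite set of vectors. Average [F] repeatedly, over longer and longer progressions in all the
    directions [a] of [l]. The supremum of [x |-> sum_(a in l) |F(x + a) - F(x)|] never increases,
    so at some stage it is almost stationary; there, at some point [p], each difference
    [F(p + a) - F(p)] has almost the norm of [a], because the average of the norms along a long
    progression telescopes. The last averaging also makes second differences small, so that
    [a |-> F(p + a) - F(p)] is almost additive on [l]. Taking for [l] a fine grid and extending
    linearly gives the embedding of [X_k]. *)

(** The linear maps must land in [X] itself and their distortion must not depend on the dimension.
    Derivatives need not exist in a general [X], and limits along an invariant mean lead out of it,
    so everything is done at a finite scale. The sum over [l] is bounded by a number depending only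
    on [l] and the upper coarse constant; a stage that is not almost stationary lowers the bound by
    one unit. Hence the number of stages, then their lengths and the radius of the ball, are fixed
    before the map is given. The dimension affects only these sizes; the two slopes survive. For the
    embedding of the graph, the gap between the squares of [a < b] is [(b - a)(b + a)], hence at
    least [a + b], which separates two balls. But a ball of radius [q] also faces points of the ray
    that are much closer to its centre than [q], and no choice of [A] separates it from them: these
    pairs are the reason for transversality. The room to achieve it comes from the growth of
    dimensions, which supplies a direction outside the given space. *)

(** * Vector identities by reflection *)

Inductive vexp : Type :=
  | VAtom (i : nat)
  | VZero
  | VAdd (s t : vexp)
  | VOpp (s : vexp)
  | VScal (a : R) (s : vexp).

Fixpoint veval {X : NormedSpace} (env : list X) (s : vexp) : X :=
  match s with
  | VAtom i => nth i env vzero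
  | VZero => vzero
  | VAdd s t => vadd (veval env s) (veval env t)
  | VOpp s => vopp (veval env s)
  | VScal a s => vscal a (veval env s)
  end.

Fixpoint vcoef (s : vexp) (i : nat) : R :=
  match s with
  | VAtom j => if Nat.eqb i j then 1 else 0
  | VZero => 0
  | VAdd s t => vcoef s i + vcoef t i
  | VOpp s => - vcoef s i
  | VScal a s => a * vcoef s i
  end.

Fixpoint vsum {X : NormedSpace} (n : nat) (f : nat -> X) : X :=
  match n with
  | O => vzero
  | S n => vadd (vsum n f) (f n)
  end.

Section Algebra.
Context {X : NormedSpace}.
Implicit Types x y z : X.

Lemma vadd_cancel x y z : vadd x z = vadd y z -> x = y.
Proof.
  intros H. rewrite <- (vadd_zero _ x), <- (vadd_zero _ y), <- (vadd_opp _ z).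
  now rewrite !vadd_assoc, H.
Qed.

Lemma vscal_0 x : vscal 0 x = vzero.
Proof.
  apply (vadd_cancel _ _ (vscal 0 x)).
  rewrite <- vscal_distr_s, (vadd_comm _ vzero), vadd_zero. f_equal; ring.
Qed.

Lemma vscal_vzero a : vscal a (@vzero X) = vzero.
Proof. rewrite <- (vscal_0 vzero), vscal_assoc. f_equal; ring. Qed.

Lemma vopp_scal x : vopp x = vscal (-1) x.
Proof.
  apply (vadd_cancel _ _ x). rewrite (vadd_comm _ (vopp x)), vadd_opp.
  rewrite <- (vscal_one _ x) at 2. rewrite <- vscal_distr_s.
  replace (-1 + 1) with 0 by ring. now rewrite vscal_0.
Qed.

Lemma vadd_swap x y z t : vadd (vadd x y) (vadd z t) = vadd (vadd x z) (vadd y t).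
Proof.
  rewrite !vadd_assoc. f_equal. rewrite <- !vadd_assoc. f_equal. apply vadd_comm.
Qed.

Lemma vsum_ext n (f g : nat -> X) : (forall i, (i < n)%nat -> f i = g i) -> vsum n f = vsum n g.
Proof.
  induction n as [|n IH]; intros H; cbn; [easy|].
  rewrite IH, H by (intros; try apply H; lia). easy.
Qed.

Lemma vsum_add n (f g : nat -> X) :
  vsum n (fun i => vadd (f i) (g i)) = vadd (vsum n f) (vsum n g).
Proof. induction n as [|n IH]; cbn; [now rewrite vadd_zero|]. now rewrite IH, vadd_swap. Qed.

Lemma vsum_scal n a (f : nat -> X) : vsum n (fun i => vscal a (f i)) = vscal a (vsum n f).
Proof. induction n as [|n IH]; cbn; [now rewrite vscal_vzero|]. now rewrite IH, vscal_distr_v. Qed.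

Lemma vsum_zero n : vsum n (fun _ => @vzero X) = vzero.
Proof. induction n as [|n IH]; cbn; [easy|]. now rewrite IH, vadd_zero. Qed.

Lemma vsum_delta n (f : nat -> X) j : (j < n)%nat ->
  vsum n (fun i => vscal (if Nat.eqb i j then 1 else 0) (f i)) = f j.
Proof.
  induction n as [|n IH]; intros H; [lia|]. cbn.
  destruct (Nat.eqb_spec n j) as [->|Hn].
  - rewrite vscal_one, (vsum_ext _ _ (fun _ => vzero)).
    + now rewrite vsum_zero, vadd_comm, vadd_zero.
    + intros i Hi. destruct (Nat.eqb_spec i j); [lia|apply vscal_0].
  - rewrite IH, vscal_0, vadd_zero by lia. easy.
Qed.

Lemma veval_coef (env : list X) s :
  veval env s = vsum (length env) (fun i => vscal (vcoef s i) (nth i env vzero)).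
Proof.
  induction s as [j| |s IHs t IHt|s IHs|a s IHs]; cbn [veval vcoef].
  - destruct (Nat.lt_ge_cases j (length env)) as [H|H].
    + now rewrite (vsum_delta _ (fun i => nth i env vzero)).
    + rewrite nth_overflow by easy. rewrite (vsum_ext _ _ (fun _ => vzero)); [now rewrite vsum_zero|].
      intros i Hi. destruct (Nat.eqb_spec i j); [lia|apply vscal_0].
  - rewrite (vsum_ext _ _ (fun _ => vzero)); [now rewrite vsum_zero|]. intros; apply vscal_0.
  - rewrite IHs, IHt, <- vsum_add. apply vsum_ext; intros. now rewrite vscal_distr_s.
  - rewrite IHs, vopp_scal, <- vsum_scal. apply vsum_ext; intros.
    rewrite vscal_assoc. f_equal; ring.
  - rewrite IHs, <- vsum_scal. apply vsum_ext; intros. now rewrite vscal_assoc.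
Qed.

(** A recursive conjunction, not a quantified statement, so that [cbn] turns it into explicit real
    identities for [ring] and [field]. *)
Fixpoint vcheck (n i : nat) (s t : vexp) : Prop :=
  match n with
  | O => True
  | S n => vcoef s i = vcoef t i /\ vcheck n (S i) s t
  end.

Lemma vcheck_sound (env : list X) s t : vcheck (length env) 0 s t -> veval env s = veval env t.
Proof.
  intros H. rewrite !veval_coef. apply vsum_ext. intros i Hi. f_equal.
  assert (G : forall n k, vcheck n k s t -> forall j, (j < n)%nat -> vcoef s (k + j) = vcoef t (k + j)).
  { clear. intros n. induction n as [|n IH]; intros k Hk j Hj; [lia|].
    destruct Hk as [H0 Hk]. destruct j as [|j]; [now rewrite Nat.add_0_r|].
    replace (k + S j)%nat with (S k + j)%nat by lia. apply IH; [easy|lia]. }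
  exact (G _ _ H i Hi).
Qed.

End Algebra.

Ltac vatoms env t :=
  lazymatch t with
  | vzero => env
  | vadd ?a ?b => let e := vatoms env a in vatoms e b
  | vsub ?a ?b => let e := vatoms env a in vatoms e b
  | vopp ?a => vatoms env a
  | vscal _ ?a => vatoms env a
  | _ =>
      let rec mem l :=
        lazymatch l with
        | nil => constr:(cons t env)
        | cons t _ => env
        | cons _ ?l => mem l
        end in
      mem env
  end.

Ltac vindex env t :=
  lazymatch env with
  | cons t _ => constr:(O)
  | cons _ ?l => let n := vindex l t in constr:(S n)
  end.

Ltac vreify env t :=
  lazymatch t with
  | vzero => constr:(VZero)
  | vadd ?a ?b => let s := vreify env a in let r := vreify env b in constr:(VAdd s r)
  | vsub ?a ?b => let s := vreify env a in let r := vreify env b in constr:(VAdd s (VOpp r))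
  | vopp ?a => let s := vreify env a in constr:(VOpp s)
  | vscal ?c ?a => let s := vreify env a in constr:(VScal c s)
  | _ => let n := vindex env t in constr:(VAtom n)
  end.

(** Reduces an identity between vectors to the equalities of the coefficients
    of the atoms, which must then be identities between reals. *)
Ltac vec_coefs :=
  lazymatch goal with
  | |- @eq (carrier ?X) ?a ?b =>
      let e := vatoms (@nil (carrier X)) a in
      let env := vatoms e b in
      let s := vreify env a in
      let t := vreify env b in
      change (veval env s = veval env t);
      apply vcheck_sound; cbn [vcheck length vcoef Nat.eqb]
  end.

Ltac vec := vec_coefs; repeat split; try ring; try (field; auto with real).

Section Norm.
Context {X : NormedSpace}.
Implicit Types x y z : X.

Lemma vnorm_vzero : vnorm (@vzero X) = 0.
Proof. rewrite <- (vscal_0 vzero), vnorm_scal, Rabs_R0. ring. Qed.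

Lemma vnorm_opp x : vnorm (vopp x) = vnorm x.
Proof. rewrite vopp_scal, vnorm_scal, Rabs_left by lra. ring. Qed.

Lemma vnorm_sub_sym x y : vnorm (vsub x y) = vnorm (vsub y x).
Proof. rewrite <- (vnorm_opp (vsub x y)). f_equal. vec. Qed.

Lemma vnorm_pos x : 0 <= vnorm x.
Proof.
  pose proof (vnorm_triangle _ x (vopp x)) as H.
  rewrite vadd_opp, vnorm_vzero, vnorm_opp in H. lra.
Qed.

Lemma vnorm_le_add x y z : x = vadd y z -> vnorm x <= vnorm y + vnorm z.
Proof. intros ->. apply vnorm_triangle. Qed.

Lemma vnorm_le_sub x y z : x = vsub y z -> vnorm x <= vnorm y + vnorm z.
Proof. intros ->. unfold vsub. rewrite <- (vnorm_opp z). apply vnorm_triangle. Qed.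

Lemma vsub_self x : vnorm (vsub x x) = 0.
Proof. replace (vsub x x) with (@vzero X) by vec. apply vnorm_vzero. Qed.

Lemma vsub_norm_0 x y : vnorm (vsub x y) = 0 -> x = y.
Proof.
  intros H%vnorm_zero. replace x with (vadd (vsub x y) y) by vec. rewrite H. vec.
Qed.

Lemma vnorm_pos_lt x : x <> vzero -> 0 < vnorm x.
Proof.
  intros H. destruct (Rle_lt_or_eq_dec _ _ (vnorm_pos x)) as [H'|H']; [easy|].
  now destruct H; apply vnorm_zero.
Qed.

Lemma vnorm_scal_pos a x : 0 <= a -> vnorm (vscal a x) = a * vnorm x.
Proof. intros H. now rewrite vnorm_scal, Rabs_pos_eq. Qed.

Lemma vnorm_vsum n (f : nat -> X) b :
  (forall i, (i < n)%nat -> vnorm (f i) <= b) -> vnorm (vsum n f) <= INR n * b.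
Proof.
  induction n as [|n IH]; intros H; [cbn; rewrite vnorm_vzero; lra|].
  rewrite S_INR. cbn [vsum].
  pose proof (vnorm_triangle _ (vsum n f) (f n)). pose proof (H n ltac:(lia)).
  enough (vnorm (vsum n f) <= INR n * b) by lra. apply IH. intros; apply H; lia.
Qed.

Lemma vsum_sub n (f g : nat -> X) :
  vsum n (fun i => vsub (f i) (g i)) = vsub (vsum n f) (vsum n g).
Proof. induction n as [|n IH]; cbn; [vec|]. rewrite IH. vec. Qed.

Lemma vsum_swap n m (f : nat -> nat -> X) :
  vsum n (fun i => vsum m (f i)) = vsum m (fun j => vsum n (fun i => f i j)).
Proof.
  induction n as [|n IH]; cbn; [now rewrite vsum_zero|]. now rewrite vsum_add, IH.
Qed.

Lemma vsum_head n (f : nat -> X) : vsum (S n) f = vadd (f O) (vsum n (fun i => f (S i))).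
Proof.
  induction n as [|n IH]; [cbn; vec|]. cbn [vsum] in *. rewrite IH. cbn. vec.
Qed.

Lemma vsum_telescope n (f : nat -> X) : vsum n (fun i => vsub (f (S i)) (f i)) = vsub (f n) (f O).
Proof. induction n as [|n IH]; cbn; [vec|]. rewrite IH. vec. Qed.

Lemma vsum_const n x : vsum n (fun _ => x) = vscal (INR n) x.
Proof. induction n as [|n IH]; [cbn; vec|]. rewrite S_INR. cbn [vsum]. rewrite IH. vec. Qed.

End Norm.

(** Makes sums and averages of real functions, in particular of norms, instances of [vsum], [avg]
    and [avgs]. It is transparent so that its operations compute to those of [R]. *)
Definition Rspace : NormedSpace.
Proof.
  refine (Build_NormedSpace R 0 Rplus Ropp Rmult Rabs _ _ _ _ _ _ _ _ _ _ _);
    intros; try ring.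
  - destruct (Req_dec x 0) as [|H0]; [easy|]. now apply Rabs_no_R0 in H0.
  - apply Rabs_mult.
  - apply Rabs_triang.
Defined.

(** * Finite-dimensional subspaces *)

Definition lc {X : NormedSpace} (n : nat) (c : nat -> R) (v : nat -> X) : X :=
  vsum n (fun i => vscal (c i) (v i)).

Definition span {X : NormedSpace} (n : nat) (v : nat -> X) (x : X) : Prop :=
  exists c, x = lc n c v.

Definition indep {X : NormedSpace} (n : nat) (v : nat -> X) : Prop :=
  forall c, lc n c v = vzero -> forall i, (i < n)%nat -> c i = 0.

Definition subspace {X : NormedSpace} (V : X -> Prop) : Prop :=
  V vzero /\ (forall x y, V x -> V y -> V (vadd x y)) /\ (forall a x, V x -> V (vscal a x)).

Definition complete {X : NormedSpace} (V : X -> Prop) : Prop :=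
  forall x : nat -> X, (forall n, V (x n)) ->
    (forall eps, 0 < eps -> exists N, forall m n, (N <= m)%nat -> (N <= n)%nat ->
        vnorm (vsub (x m) (x n)) < eps) ->
    exists l, V l /\ forall eps, 0 < eps -> exists N, forall n, (N <= n)%nat ->
        vnorm (vsub (x n) l) < eps.

Section FiniteDimension.
Context {X : NormedSpace}.
Implicit Types (x y : X) (v : nat -> X) (V : X -> Prop).

Lemma subspace_opp V x : subspace V -> V x -> V (vopp x).
Proof. intros (_ & _ & H) Hx. rewrite vopp_scal. now apply H. Qed.

Lemma subspace_sub V x y : subspace V -> V x -> V y -> V (vsub x y).
Proof. intros H Hx Hy. apply H; [easy|]. now apply subspace_opp. Qed.

Lemma lc_ext n c c' v : (forall i, (i < n)%nat -> c i = c' i) -> lc n c v = lc n c' v.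
Proof. intros H. apply vsum_ext. intros i Hi. now rewrite H. Qed.

Lemma lc_add n c c' v : lc n (fun i => c i + c' i) v = vadd (lc n c v) (lc n c' v).
Proof. unfold lc. rewrite <- vsum_add. apply vsum_ext; intros. vec. Qed.

Lemma vsum_vscal_const n (r : nat -> R) x :
  vsum n (fun i => vscal (r i) x) = vscal (@vsum Rspace n r) x.
Proof. induction n as [|n IH]; cbn; [vec|]. rewrite IH. vec. Qed.

Lemma lc_scal n a c v : lc n (fun i => a * c i) v = vscal a (lc n c v).
Proof. unfold lc. rewrite <- vsum_scal. apply vsum_ext; intros. vec. Qed.

Lemma lc_sub n c c' v : lc n (fun i => c i - c' i) v = vsub (lc n c v) (lc n c' v).
Proof. unfold lc. rewrite <- vsum_sub. apply vsum_ext; intros. vec. Qed.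

Lemma lc_delta n v j : (j < n)%nat -> lc n (fun i => if Nat.eqb i j then 1 else 0) v = v j.
Proof. apply vsum_delta. Qed.

Lemma span_subspace n v : subspace (span n v).
Proof.
  split; [|split].
  - exists (fun _ => 0). unfold lc. rewrite (vsum_ext _ _ (fun _ => vzero)); [now rewrite vsum_zero|].
    intros; apply vscal_0.
  - intros x y [c ->] [c' ->]. exists (fun i => c i + c' i). now rewrite lc_add.
  - intros a x [c ->]. exists (fun i => a * c i). now rewrite lc_scal.
Qed.

Lemma span_S n v x : span (S n) v x <-> exists w a, span n v w /\ x = vadd w (vscal a (v n)).
Proof.
  split.
  - intros [c ->]. exists (lc n c v), (c n). split; [now exists c|easy].
  - intros (w & a & [c ->] & ->). exists (fun i => if Nat.eqb i n then a else c i).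
    unfold lc at 2. cbn [vsum]. rewrite Nat.eqb_refl. f_equal. apply vsum_ext.
    intros i Hi. destruct (Nat.eqb_spec i n); [lia|easy].
Qed.

Lemma lc_extend n c a v :
  lc (S n) (fun i => if Nat.eqb i n then a else c i) v = vadd (lc n c v) (vscal a (v n)).
Proof.
  unfold lc. cbn [vsum]. rewrite Nat.eqb_refl. f_equal. apply vsum_ext.
  intros i Hi. destruct (Nat.eqb_spec i n); [lia|easy].
Qed.

Lemma indep_pred n v : indep (S n) v -> indep n v.
Proof.
  intros H c Hc i Hi.
  assert (E : (if Nat.eqb i n then 0 else c i) = 0).
  { apply (H (fun i => if Nat.eqb i n then 0 else c i)); [|lia].
    rewrite lc_extend, Hc. vec. }
  destruct (Nat.eqb_spec i n); [lia|easy].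
Qed.

Lemma indep_last n v : indep (S n) v -> ~ span n v (v n).
Proof.
  intros H [c Hc].
  assert (E : (if Nat.eqb n n then -1 else c n) = 0).
  { apply (H (fun i => if Nat.eqb i n then -1 else c i)); [|lia].
    rewrite lc_extend, <- Hc. vec. }
  rewrite Nat.eqb_refl in E. lra.
Qed.

Lemma inv_nat_small eps : 0 < eps -> exists N, forall n, (N <= n)%nat -> / (INR n + 1) < eps.
Proof.
  intros H. destruct (archimed_cor1 eps H) as (N & HN & HN0). exists N. intros n Hn.
  apply Rlt_trans with (2 := HN). apply Rinv_lt_contravar.
  - apply Rmult_lt_0_compat; [now apply lt_0_INR|pose proof (pos_INR n); lra].
  - apply le_INR in Hn. lra.
Qed.

(** Otherwise points of [V] within [1/(n+1)] of [x] form a Cauchy sequence whose limit in [V] is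
    [x]. *)
Lemma complete_dist_pos V x : complete V -> ~ V x ->
  exists rho, 0 < rho /\ forall w, V w -> rho <= vnorm (vsub x w).
Proof.
  intros HV Hx. apply NNPP. intros Hn.
  assert (Hw : forall n, exists w, V w /\ vnorm (vsub x w) < / (INR n + 1)).
  { intros n. apply NNPP. intros H. apply Hn. exists (/ (INR n + 1)). split.
    - apply Rinv_0_lt_compat. pose proof (pos_INR n); lra.
    - intros w Hw. apply Rnot_lt_le. intros Hlt. apply H. now exists w. }
  set (w n := proj1_sig (constructive_indefinite_description _ (Hw n))).
  assert (Hww : forall n, V (w n) /\ vnorm (vsub x (w n)) < / (INR n + 1))
    by (intros n; unfold w; now destruct constructive_indefinite_description).
  destruct (HV w) as (l & Hl & Hlim).
  - intros n; apply Hww.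
  - intros eps He. destruct (inv_nat_small (eps / 2) ltac:(lra)) as [N HN]. exists N.
    intros m n Hm Hn'. pose proof (HN m Hm). pose proof (HN n Hn').
    pose proof (proj2 (Hww m)). pose proof (proj2 (Hww n)).
    pose proof (vnorm_le_sub (vsub (w m) (w n)) (vsub x (w n)) (vsub x (w m)) ltac:(vec)). lra.
  - apply Hx. replace x with l; [easy|]. apply eq_sym, vsub_norm_0.
    apply Rle_antisym; [|apply vnorm_pos]. apply le_epsilon. intros eps He.
    destruct (inv_nat_small (eps / 2) ltac:(lra)) as [N HN].
    destruct (Hlim (eps / 2) ltac:(lra)) as [M HM].
    pose proof (HN (N + M)%nat ltac:(lia)). pose proof (HM (N + M)%nat ltac:(lia)).
    pose proof (proj2 (Hww (N + M)%nat)).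
    pose proof (vnorm_le_add (vsub x l) (vsub x (w (N + M)%nat)) (vsub (w (N + M)%nat) l) ltac:(vec)).
    lra.
Qed.

(** The two claims need a joint induction: completeness of the smaller span puts [v n] at positive
    distance from it, which controls the last coordinate; this controls the remaining part of the
    vector, hence the other coordinates and convergence. *)
Lemma fin_dim_coord_complete n v : indep n v ->
  (exists k, 0 < k /\ forall c i, (i < n)%nat -> k * Rabs (c i) <= vnorm (lc n c v)) /\
  complete (span n v).
Proof.
  induction n as [|n IH]; intros Hv.
  { split; [exists 1; split; [lra|lia]|].
    intros x Hx _. exists vzero. split; [apply span_subspace|].
    intros eps He. exists O. intros m _. destruct (Hx m) as [c ->]. cbn.
    rewrite (vsub_self (X := X)). easy. }
  destruct (IH (indep_pred _ _ Hv)) as [(k & Hk & Hkc) Hcomp].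
  destruct (complete_dist_pos _ _ Hcomp (indep_last _ _ Hv)) as (rho & Hrho & Hd).
  assert (Hlast : forall w a, span n v w -> rho * Rabs a <= vnorm (vadd w (vscal a (v n)))).
  { intros w a Hw. destruct (Req_dec a 0) as [->|Ha].
    - rewrite Rabs_R0, Rmult_0_r. apply vnorm_pos.
    - replace (vadd w (vscal a (v n))) with (vscal a (vsub (v n) (vscal (- / a) w))) by vec.
      rewrite vnorm_scal, Rmult_comm. apply Rmult_le_compat_l; [apply Rabs_pos|].
      apply Hd. now apply span_subspace. }
  split.
  (* Removing the term along [v n] from a vector of norm [N] changes it by at most
     [N * vnorm (v n) / rho], so what remains has norm at most [b * N]. *)
  - set (b := 1 + vnorm (v n) / rho).
    assert (Hb : 1 <= b).
    { assert (0 <= vnorm (v n) / rho); [|unfold b; lra].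
      apply Rmult_le_pos; [apply vnorm_pos|]. now apply Rlt_le, Rinv_0_lt_compat. }
    exists (Rmin rho (k / b)). split.
    { apply Rmin_glb_lt; [easy|]. apply Rdiv_lt_0_compat; lra. }
    intros c i Hi. change (lc (S n) c v) with (vadd (lc n c v) (vscal (c n) (v n))).
    assert (Hn : rho * Rabs (c n) <= vnorm (vadd (lc n c v) (vscal (c n) (v n))))
      by (apply Hlast; now exists c).
    set (N := vnorm (vadd (lc n c v) (vscal (c n) (v n)))) in *.
    destruct (Nat.eq_dec i n) as [->|Hin].
    + apply Rle_trans with (2 := Hn). apply Rmult_le_compat_r; [apply Rabs_pos|apply Rmin_l].
    + apply Rle_trans with (k / b * Rabs (c i)).
      { apply Rmult_le_compat_r; [apply Rabs_pos|apply Rmin_r]. }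
      pose proof (Hkc c i ltac:(lia)) as Hi'.
      pose proof (vnorm_le_sub (lc n c v) (vadd (lc n c v) (vscal (c n) (v n))) (vscal (c n) (v n))
        ltac:(vec)) as Ht.
      fold N in Ht. rewrite vnorm_scal in Ht.
      assert (Rabs (c n) * vnorm (v n) <= N * (b - 1)).
      { replace (N * (b - 1)) with ((N / rho) * vnorm (v n)) by (unfold b; field; lra).
        apply Rmult_le_compat_r; [apply vnorm_pos|].
        apply (Rmult_le_reg_l rho); [easy|]. replace (rho * (N / rho)) with N by (field; lra). easy. }
      apply (Rmult_le_reg_l b); [lra|].
      replace (b * (k / b * Rabs (c i))) with (k * Rabs (c i)) by (field; lra). lra.
  - intros x Hx Hc.
    assert (Hx' : forall m, exists p, span n v (fst p) /\ x m = vadd (fst p) (vscal (snd p) (v n))).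
    { intros m. destruct (proj1 (span_S _ _ _) (Hx m)) as (w & a & H). now exists (w, a). }
    set (p m := proj1_sig (constructive_indefinite_description _ (Hx' m))).
    assert (Hp : forall m, span n v (fst (p m)) /\ x m = vadd (fst (p m)) (vscal (snd (p m)) (v n)))
      by (intros m; unfold p; now destruct constructive_indefinite_description).
    set (w m := fst (p m)) in *. set (a m := snd (p m)) in *.
    assert (Hw : forall m, span n v (w m)) by apply Hp.
    assert (Hxw : forall m, x m = vadd (w m) (vscal (a m) (v n))) by apply Hp.
    assert (Hak : forall m j, rho * Rabs (a m - a j) <= vnorm (vsub (x m) (x j))).
    { intros m j. rewrite !Hxw.
      replace (vsub _ _) with (vadd (vsub (w m) (w j)) (vscal (a m - a j) (v n))) by vec.
      apply Hlast. now apply subspace_sub; [apply span_subspace| |]. }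
    destruct (R_complete a) as [al Hal].
    { intros eps He. destruct (Hc (rho * eps)) as [N HN]; [now apply Rmult_lt_0_compat|].
      exists N. intros m j Hm Hj. unfold Rdist. apply (Rmult_lt_reg_l rho); [easy|].
      apply Rle_lt_trans with (1 := Hak m j). now apply HN. }
    destruct (Hcomp w Hw) as (wl & Hwl & Hlim).
    { intros eps He. set (b := 1 + vnorm (v n) / rho).
      assert (Hb : 1 <= b).
      { assert (0 <= vnorm (v n) / rho); [|unfold b; lra].
        apply Rmult_le_pos; [apply vnorm_pos|]. now apply Rlt_le, Rinv_0_lt_compat. }
      destruct (Hc (eps / b)) as [N HN]; [apply Rdiv_lt_0_compat; lra|].
      exists N. intros m j Hm Hj. specialize (HN m j Hm Hj). specialize (Hak m j).
      pose proof (vnorm_le_sub (vsub (w m) (w j)) (vsub (x m) (x j)) (vscal (a m - a j) (v n))) as Ht.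
      rewrite !Hxw in Ht. specialize (Ht ltac:(vec)). rewrite <- !Hxw, vnorm_scal in Ht.
      set (N0 := vnorm (vsub (x m) (x j))) in *.
      assert (Rabs (a m - a j) * vnorm (v n) <= N0 * (b - 1)).
      { replace (N0 * (b - 1)) with ((N0 / rho) * vnorm (v n)) by (unfold b; field; lra).
        apply Rmult_le_compat_r; [apply vnorm_pos|].
        apply (Rmult_le_reg_l rho); [easy|]. replace (rho * (N0 / rho)) with N0 by (field; lra). easy. }
      assert (N0 * b < eps); [|lra].
      apply (Rmult_lt_compat_r b) in HN; [|lra]. replace (eps / b * b) with eps in HN by (field; lra).
      easy. }
    exists (vadd wl (vscal al (v n))). split; [apply span_S; now exists wl, al|].
    intros eps He. destruct (Hlim (eps / 2) ltac:(lra)) as [N HN].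
    set (b := vnorm (v n) + 1). assert (Hb : 0 < b) by (pose proof (vnorm_pos (v n)); unfold b; lra).
    destruct (Hal (eps / 2 / b)) as [M HM]; [apply Rdiv_lt_0_compat; lra|].
    exists (N + M)%nat. intros m Hm. specialize (HN m ltac:(lia)). specialize (HM m ltac:(lia)).
    unfold Rdist in HM. rewrite Hxw.
    pose proof (vnorm_le_add (vsub (vadd (w m) (vscal (a m) (v n))) (vadd wl (vscal al (v n))))
      (vsub (w m) wl) (vscal (a m - al) (v n)) ltac:(vec)) as Ht. rewrite vnorm_scal in Ht.
    apply (Rmult_lt_compat_r b) in HM; [|easy].
    replace (eps / 2 / b * b) with (eps / 2) in HM by (field; lra).
    unfold b in HM. pose proof (Rabs_pos (a m - al)). nra.
Qed.

Lemma vsum_skip n (f : nat -> X) j : (j <= n)%nat ->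
  vsum (S n) f = vadd (vsum n (fun i => f (if Nat.ltb i j then i else S i))) (f j).
Proof.
  induction n as [|n IH]; intros Hj.
  - replace j with O by lia. cbn. vec.
  - destruct (Nat.eq_dec j (S n)) as [->|Hne].
    + cbn [vsum]. f_equal. f_equal.
      * apply vsum_ext. intros i Hi. destruct (Nat.ltb_spec i (S n)); [easy|lia].
      * destruct (Nat.ltb_spec n (S n)); [easy|lia].
    + change (vsum (S (S n)) f) with (vadd (vsum (S n) f) (f (S n))).
      rewrite IH by lia. cbn [vsum]. destruct (Nat.ltb_spec n j); [lia|]. vec.
Qed.

(** Elimination: if some [u j] involves [v n], subtracting multiples of it from the other vectors
    leaves one vector fewer, still independent, in the span of the first [n] vectors [v i]. *)
Lemma indep_span_le n v : forall m (u : nat -> X),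
  indep m u -> (forall i, (i < m)%nat -> span n v (u i)) -> (m <= n)%nat.
Proof.
  induction n as [|n IH]; intros m u Hu Hs.
  { destruct m as [|m]; [easy|]. destruct (Hs O ltac:(lia)) as [c Hc]. cbn in Hc.
    assert (E : (if Nat.eqb 0 0 then 1 else 0) = 0).
    { apply (Hu (fun i => if Nat.eqb i 0 then 1 else 0)); [|lia]. rewrite lc_delta by lia. easy. }
    cbn in E. lra. }
  destruct (classic (forall i, (i < m)%nat -> span n v (u i))) as [Hall|Hex].
  { specialize (IH m u Hu Hall). lia. }
  apply not_all_ex_not in Hex as [j Hj]. apply imply_to_and in Hj as [Hjm Hj].
  destruct m as [|m]; [lia|]. enough (m <= n)%nat by lia.
  assert (Hs' : forall i, exists p, (i < S m)%nat ->
      span n v (fst p) /\ u i = vadd (fst p) (vscal (snd p) (v n))).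
  { intros i. destruct (Nat.lt_ge_cases i (S m)) as [Hi|Hi]; [|exists (vzero, 0); lia].
    specialize (Hs i Hi). apply span_S in Hs as (w & a & H). now exists (w, a). }
  set (p i := proj1_sig (constructive_indefinite_description _ (Hs' i))).
  assert (Hp : forall i, (i < S m)%nat ->
      span n v (fst (p i)) /\ u i = vadd (fst (p i)) (vscal (snd (p i)) (v n)))
    by (intros i; unfold p; now destruct constructive_indefinite_description).
  set (w i := fst (p i)) in *. set (a i := snd (p i)) in *.
  assert (Ha : a j <> 0).
  { intros H0. apply Hj. destruct (Hp j Hjm) as [Hw ->]. fold (a j). rewrite H0.
    replace (vadd (fst (p j)) _) with (w j) by (unfold w; vec). easy. }
  set (sg i := if Nat.ltb i j then i else S i).
  assert (Hsg : forall i, (i < m)%nat -> (sg i < S m)%nat)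
    by (intros i Hi; unfold sg; destruct (Nat.ltb_spec i j); lia).
  apply (IH m (fun i => vsub (u (sg i)) (vscal (a (sg i) / a j) (u j)))).
  - intros c Hc i Hi.
    set (s := @vsum Rspace m (fun i => c i * (a (sg i) / a j))).
    (* A relation between the eliminated vectors, rewritten as a relation between the original ones;
       [u j] collects the coefficient [- s]. *)
    set (C k := if Nat.ltb k j then c k else if Nat.eqb k j then - s else c (pred k)).
    assert (HC : forall i, C (sg i) = c i).
    { intros k. unfold C, sg. destruct (Nat.ltb_spec k j) as [Hk|Hk].
      - destruct (Nat.ltb_spec k j); [easy|lia].
      - destruct (Nat.ltb_spec (S k) j); [lia|]. destruct (Nat.eqb_spec (S k) j); [lia|easy]. }
    rewrite <- HC. apply Hu; [|now apply Hsg].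
    unfold lc. rewrite (vsum_skip _ _ j) by lia. fold sg.
    rewrite <- Hc. unfold lc at 1.
    rewrite (vsum_ext m (fun i => vscal (c i) _)
      (fun i => vsub (vscal (c i) (u (sg i))) (vscal (c i * (a (sg i) / a j)) (u j))))
      by (intros; vec).
    rewrite vsum_sub, vsum_vscal_const. fold s. unfold vsub. f_equal.
    + apply vsum_ext. intros k Hk. fold (sg k). now rewrite HC.
    + unfold C. rewrite Nat.ltb_irrefl, Nat.eqb_refl. vec.
  - intros i Hi. destruct (Hp (sg i) (Hsg i Hi)) as [Hw ->]. destruct (Hp j Hjm) as [Hwj ->].
    fold (w (sg i)) (w j) (a (sg i)) (a j).
    replace (vsub _ _) with (vsub (w (sg i)) (vscal (a (sg i) / a j) (w j))) by vec.
    apply subspace_sub; [apply span_subspace|easy|]. now apply span_subspace.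
Qed.

Lemma lincomb_lc cs (vs : list X) : length cs = length vs ->
  lincomb cs vs = lc (length vs) (fun i => nth i cs 0) (fun i => nth i vs vzero).
Proof.
  revert vs. induction cs as [|c cs IH]; intros [|x vs] H; try easy.
  cbn [lincomb length]. unfold lc. rewrite vsum_head. cbn [nth]. f_equal. apply IH.
  now injection H.
Qed.

Lemma lincomb_map c (vs : list X) :
  lincomb (map c (seq 0 (length vs))) vs = lc (length vs) c (fun i => nth i vs vzero).
Proof.
  rewrite lincomb_lc by now rewrite length_map, length_seq.
  apply lc_ext. intros i Hi. rewrite (nth_indep _ _ (c O)) by now rewrite length_map, length_seq.
  now rewrite map_nth, seq_nth.
Qed.

Lemma has_dim_basis V d : has_dim V d -> exists v, indep d v /\ forall x, V x <-> span d v x.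
Proof.
  intros (vs & <- & Hi & HV). exists (fun i => nth i vs vzero). split.
  - intros c Hc i Hlt. rewrite <- lincomb_map in Hc.
    apply Hi in Hc; [|now rewrite length_map, length_seq].
    rewrite Forall_forall in Hc. apply Hc, in_map_iff. exists i. split; [easy|].
    apply in_seq. lia.
  - intros x. rewrite HV. split.
    + intros (cs & Hl & ->). rewrite lincomb_lc by easy. eexists; reflexivity.
    + intros [c ->]. exists (map c (seq 0 (length vs))). rewrite lincomb_map.
      now rewrite length_map, length_seq.
Qed.

End FiniteDimension.

(** * Averages along progressions *)

Definition diff {E X : NormedSpace} (a : E) (u : E -> X) (x : E) : X :=
  vsub (u (vadd x a)) (u x).

Definition avg {E X : NormedSpace} (a : E) (L : nat) (u : E -> X) (x : E) : X :=
  vscal (/ INR L) (vsum L (fun j => u (vadd x (vscal (INR j) a)))).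

Fixpoint avgs {E X : NormedSpace} (l : list E) (L : nat) (u : E -> X) : E -> X :=
  match l with
  | nil => u
  | a :: l => avg a L (avgs l L u)
  end.

Fixpoint lsum {A : Type} (f : A -> R) (l : list A) : R :=
  match l with
  | nil => 0
  | a :: l => f a + lsum f l
  end.

Lemma lsum_nonneg {A} (f : A -> R) l : (forall a, 0 <= f a) -> 0 <= lsum f l.
Proof. intros H. induction l as [|a l IH]; cbn; [lra|]. pose proof (H a). lra. Qed.

Lemma lsum_ge {A} (f : A -> R) l a : (forall a, 0 <= f a) -> In a l -> f a <= lsum f l.
Proof.
  intros H. induction l as [|b l IH]; cbn; [easy|]. intros [->|Ha].
  - pose proof (lsum_nonneg f l H). lra.
  - specialize (IH Ha). pose proof (H b). lra.
Qed.

Lemma lsum_le {A} (f g : A -> R) l : (forall a, In a l -> f a <= g a) -> lsum f l <= lsum g l.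
Proof.
  induction l as [|b l IH]; cbn; intros H; [lra|].
  pose proof (H b (or_introl eq_refl)). specialize (IH (fun a Ha => H a (or_intror Ha))). lra.
Qed.

(** Passes from an almost equality of total energies to one for each single direction. *)
Lemma lsum_gap {A} (f g : A -> R) l a e :
  (forall a, In a l -> f a <= g a) -> lsum g l <= lsum f l + e -> In a l -> g a <= f a + e.
Proof.
  induction l as [|b l IH]; cbn; intros H Hs; [easy|]. intros [->|Ha].
  - pose proof (lsum_le f g l (fun a Ha => H a (or_intror Ha))). lra.
  - apply IH; [|pose proof (H b (or_introl eq_refl)); lra|easy]. intros; apply H; now right.
Qed.

Section Averages.
Context {E X : NormedSpace} (L : nat) (HL : (0 < L)%nat).
Implicit Types (a b x y : E) (u w : E -> X) (phi psi : E -> Rspace) (l : list E).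

Lemma INR_L_pos : 0 < INR L.
Proof. now apply lt_0_INR. Qed.

(** Two functions and two base points are allowed, so that one bound serves to compare values of an
    average, to compare an average with a constant, and to compare averaged differences. *)
Lemma avg_dist a u w x y e :
  (forall j, (j < L)%nat ->
     vnorm (vsub (u (vadd x (vscal (INR j) a))) (w (vadd y (vscal (INR j) a)))) <= e) ->
  vnorm (vsub (avg a L u x) (avg a L w y)) <= e.
Proof.
  intros H. unfold avg. pose proof INR_L_pos as HL0.
  replace (vsub _ _) with (vscal (/ INR L) (vsum L (fun j =>
    vsub (u (vadd x (vscal (INR j) a))) (w (vadd y (vscal (INR j) a))))))
    by (rewrite vsum_sub; vec).
  rewrite vnorm_scal_pos by now apply Rlt_le, Rinv_0_lt_compat.
  apply (Rmult_le_reg_l (INR L)); [easy|]. rewrite <- Rmult_assoc, Rinv_r, Rmult_1_l by lra.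
  now apply vnorm_vsum.
Qed.

Lemma avg_const a (z : X) x : avg a L (fun _ => z) x = z.
Proof. unfold avg. rewrite vsum_const. pose proof INR_L_pos. vec. Qed.

Lemma avg_diff a b u x : diff b (avg a L u) x = avg a L (diff b u) x.
Proof.
  unfold diff, avg. rewrite vsum_sub.
  rewrite (vsum_ext _ (fun j => u (vadd (vadd x b) (vscal (INR j) a)))
    (fun j => u (vadd (vadd x (vscal (INR j) a)) b))); [vec|].
  intros. f_equal. vec.
Qed.

Lemma avg_comm a b u x : avg a L (avg b L u) x = avg b L (avg a L u) x.
Proof.
  unfold avg. rewrite !vsum_scal, vsum_swap. do 2 f_equal.
  apply vsum_ext; intros i _. apply vsum_ext; intros j _. f_equal. vec.
Qed.

Lemma avg_avgs_comm a l u : avg a L (avgs l L u) = avgs l L (avg a L u).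
Proof.
  induction l as [|b l IH]; cbn; [easy|]. rewrite <- IH.
  apply functional_extensionality. intros x. apply avg_comm.
Qed.

Lemma avgs_diff b l u x : diff b (avgs l L u) x = avgs l L (diff b u) x.
Proof.
  revert x. induction l as [|a l IH]; intros x; cbn; [easy|]. rewrite avg_diff.
  f_equal. now apply functional_extensionality.
Qed.

(** Telescoping makes this a difference quotient over a step of length [L]. Both gains from long
    averages come from here: small second differences, and norms nearly as large as coarse geometry
    predicts. *)
Lemma avg_step a u x :
  diff a (avg a L u) x = vscal (/ INR L) (vsub (u (vadd x (vscal (INR L) a))) (u x)).
Proof.
  rewrite avg_diff. unfold avg, diff. f_equal.
  rewrite (vsum_ext _ _ (fun j => vsub (u (vadd x (vscal (INR (S j)) a)))
                                       (u (vadd x (vscal (INR j) a))))).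
  - rewrite (vsum_telescope L (fun j => u (vadd x (vscal (INR j) a)))). f_equal. f_equal. cbn. vec.
  - intros j _. rewrite S_INR. do 2 f_equal. vec.
Qed.

End Averages.

Section RealAverages.
Context {E : NormedSpace} (L : nat) (HL : (0 < L)%nat).
Implicit Types (a b x y : E) (phi psi : E -> Rspace) (l : list E).

Lemma vsum_le n (f g : nat -> Rspace) :
  (forall j, (j < n)%nat -> f j <= g j) -> vsum n f <= vsum n g.
Proof.
  induction n as [|n IH]; intros H; cbn; [lra|].
  pose proof (H n ltac:(lia)). specialize (IH (fun j Hj => H j ltac:(lia))). cbn in *. lra.
Qed.

Lemma avg_le a phi psi x :
  (forall j, (j < L)%nat -> phi (vadd x (vscal (INR j) a)) <= psi (vadd x (vscal (INR j) a))) ->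
  avg a L phi x <= avg a L psi x.
Proof.
  intros H. unfold avg. apply Rmult_le_compat_l.
  - apply Rlt_le, Rinv_0_lt_compat. now apply lt_0_INR.
  - now apply vsum_le.
Qed.

Lemma vnorm_vsum_le {X : NormedSpace} n (f : nat -> X) :
  vnorm (vsum n f) <= @vsum Rspace n (fun j => vnorm (f j)).
Proof.
  induction n as [|n IH]; cbn; [rewrite vnorm_vzero; lra|].
  pose proof (vnorm_triangle _ (vsum n f) (f n)). lra.
Qed.

Lemma avg_norm {X : NormedSpace} a (u : E -> X) x :
  vnorm (avg a L u x) <= avg (X := Rspace) a L (fun y => vnorm (u y)) x.
Proof.
  assert (0 <= / INR L) by (apply Rlt_le, Rinv_0_lt_compat; now apply lt_0_INR).
  unfold avg. rewrite vnorm_scal_pos by easy. apply Rmult_le_compat_l; [easy|].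
  apply vnorm_vsum_le.
Qed.

Lemma avgs_norm {X : NormedSpace} l (u : E -> X) x :
  vnorm (avgs l L u x) <= avgs (X := Rspace) l L (fun y => vnorm (u y)) x.
Proof.
  revert x. induction l as [|a l IH]; intros x; cbn [avgs]; [lra|].
  eapply Rle_trans; [apply avg_norm|]. apply avg_le. intros; apply IH.
Qed.

Lemma avgs_add l phi psi x :
  avgs (X := Rspace) l L (fun y => phi y + psi y) x = avgs l L phi x + avgs l L psi x.
Proof.
  revert x. induction l as [|a l IH]; intros x; cbn [avgs]; [easy|].
  unfold avg. change Rplus with (@vadd Rspace). rewrite <- vscal_distr_v. f_equal.
  rewrite <- vsum_add. apply vsum_ext; intros. apply IH.
Qed.

Lemma avgs_const l (z : R) x : avgs (X := Rspace) l L (fun _ => z) x = z.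
Proof.
  revert x. induction l as [|a l IH]; intros x; cbn [avgs]; [easy|].
  replace (avgs (X := Rspace) l L (fun _ => z)) with (fun _ : E => z : Rspace)
    by (apply functional_extensionality; intros; now rewrite IH).
  now apply (avg_const (X := Rspace)).
Qed.

Lemma avgs_lsum {A : Type} l (f : A -> E -> R) (s : list A) x :
  avgs (X := Rspace) l L (fun y => lsum (fun i => f i y) s) x
  = lsum (fun i => avgs (X := Rspace) l L (f i) x) s.
Proof.
  induction s as [|i s IH]; cbn [lsum]; [apply avgs_const|]. rewrite avgs_add. now rewrite IH.
Qed.

End RealAverages.

(** * Averages of coarse embeddings of balls *)

Definition dom {E : NormedSpace} (V : E -> Prop) (r : R) (x : E) : Prop := V x /\ vnorm x <= r.

(** Kept apart from the lower bound because averaging preserves [C], while the additive error [D] of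
    the lower bound grows at each stage. *)
Definition coarse_up {E X : NormedSpace} (V : E -> Prop) (C r : R) (G : E -> X) : Prop :=
  forall x y, dom V r x -> dom V r y -> vnorm (vsub (G x) (G y)) <= C * (vnorm (vsub x y) + 1).

Definition coarse_low {E X : NormedSpace} (V : E -> Prop) (D r : R) (G : E -> X) : Prop :=
  forall x y, dom V r x -> dom V r y -> vnorm (vsub x y) - D <= vnorm (vsub (G x) (G y)).

Section Local.
Context {E X : NormedSpace} (V : E -> Prop) (HV : subspace V) (L : nat) (HL : (0 < L)%nat)
  (C : R) (HC : 0 <= C).
Implicit Types (a b x y : E) (u w G : E -> X) (phi psi : E -> Rspace) (l : list E).

(** Bounds the displacement of the points at which [avgs l L] samples its argument; this much radius
    is lost at each stage. *)
Definition reach l : R := INR L * lsum vnorm l.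

Lemma reach_nonneg l : 0 <= reach l.
Proof. apply Rmult_le_pos; [apply pos_INR|]. apply lsum_nonneg. intros; apply vnorm_pos. Qed.

Lemma dom_step r a x k : V a -> 0 <= k <= INR L -> dom V r x ->
  dom V (INR L * vnorm a + r) (vadd x (vscal k a)).
Proof.
  intros Ha Hk [Hx Hr]. split; [apply HV; [easy|now apply HV]|].
  pose proof (vnorm_triangle _ x (vscal k a)) as H. rewrite vnorm_scal_pos in H by easy.
  pose proof (vnorm_pos a). nra.
Qed.

Lemma dom_step_nat r a x j : V a -> (j < L)%nat -> dom V r x ->
  dom V (INR L * vnorm a + r) (vadd x (vscal (INR j) a)).
Proof.
  intros Ha Hj. apply dom_step; [easy|]. split; [apply pos_INR|]. now apply le_INR, Nat.lt_le_incl.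
Qed.

Lemma dom_le r r' x : r <= r' -> dom V r x -> dom V r' x.
Proof. intros H [Hx Hr]. split; [easy|lra]. Qed.

Lemma reach_cons a l r : r + reach (a :: l) = INR L * vnorm a + r + reach l.
Proof. unfold reach. cbn. ring. Qed.

Lemma avgs_le l : (forall a, In a l -> V a) -> forall r phi psi,
  (forall y, dom V (r + reach l) y -> phi y <= psi y) ->
  forall x, dom V r x -> avgs l L phi x <= avgs l L psi x.
Proof.
  induction l as [|a l IH]; intros Hl r phi psi H x Hx; cbn [avgs].
  - apply H. apply (dom_le r); [|easy]. unfold reach. cbn. lra.
  - apply avg_le; [easy|]. intros j Hj. apply (IH (fun b Hb => Hl b (or_intror Hb)) (INR L * vnorm a + r)).
    + intros y Hy. apply H. now rewrite reach_cons.
    + apply dom_step_nat; [apply Hl; now left|easy|easy].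
Qed.

Lemma avgs_up l : (forall a, In a l -> V a) -> forall r G,
  coarse_up V C (r + reach l) G -> coarse_up V C r (avgs l L G).
Proof.
  induction l as [|a l IH]; intros Hl r G HG x y Hx Hy; cbn [avgs].
  - apply HG; apply (dom_le r); try easy; unfold reach; cbn; lra.
  - apply avg_dist; [easy|]. intros j Hj.
    replace (vsub x y) with (vsub (vadd x (vscal (INR j) a)) (vadd y (vscal (INR j) a))) by vec.
    rewrite reach_cons in HG. apply (IH (fun b Hb => Hl b (or_intror Hb)) _ _ HG).
    + apply dom_step_nat; [apply Hl; now left|easy|easy].
    + apply dom_step_nat; [apply Hl; now left|easy|easy].
Qed.

(** Averaging along [a] moves the argument by at most [L * vnorm a]. The additive unit in
    [coarse_up] is paid once per direction, whence the term [length l]. *)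
Lemma avgs_close l : (forall a, In a l -> V a) -> forall r G,
  coarse_up V C (r + reach l) G -> forall x, dom V r x ->
  vnorm (vsub (avgs l L G x) (G x)) <= C * (reach l + INR (length l)).
Proof.
  induction l as [|a l IH]; intros Hl r G HG x Hx; cbn [avgs].
  - rewrite vsub_self. unfold reach. cbn. lra.
  - rewrite <- (avg_const L HL a (G x) x) at 1. apply avg_dist; [easy|]. intros j Hj.
    set (z := vadd x (vscal (INR j) a)).
    assert (Hz : dom V (INR L * vnorm a + r) z)
      by (apply dom_step_nat; [apply Hl; now left|easy|easy]).
    rewrite reach_cons in HG. specialize (IH (fun b Hb => Hl b (or_intror Hb)) _ _ HG z Hz).
    pose proof (reach_nonneg l) as Hr.
    assert (Hxz : vnorm (vsub z x) <= INR L * vnorm a).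
    { unfold z. replace (vsub _ _) with (vscal (INR j) a) by vec.
      rewrite vnorm_scal_pos by apply pos_INR. apply Rmult_le_compat_r; [apply vnorm_pos|].
      apply le_INR; lia. }
    assert (Hd : vnorm (vsub (G z) (G x)) <= C * (vnorm (vsub z x) + 1)).
    { apply HG; eapply dom_le; try eassumption; pose proof (pos_INR L); pose proof (vnorm_pos a); nra. }
    pose proof (vnorm_le_add (vsub (avgs l L G z) (G x)) (vsub (avgs l L G z) (G z))
      (vsub (G z) (G x)) ltac:(vec)) as Ht.
    pose proof (reach_cons a l 0) as Hc. cbn [length]. rewrite S_INR.
    replace (reach (a :: l)) with (INR L * vnorm a + reach l) by lra. nra.
Qed.

(** At the averaging along [v], [avg_step] gives [1/L] times a combination of two differences, each
    bounded by [C * (vnorm (vsub x y) + 1)]. Averages in the other directions do not worsen this. *)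
Lemma avgs_smooth l v : (forall a, In a l -> V a) -> In v l -> forall r G,
  coarse_up V C (r + reach l) G -> forall x y, dom V r x -> dom V r y ->
  vnorm (vsub (diff v (avgs l L G) x) (diff v (avgs l L G) y))
    <= 2 * C / INR L * (vnorm (vsub x y) + 1).
Proof.
  intros Hl Hv. induction l as [|a l IH]; [easy|]. intros r G HG x y Hx Hy.
  assert (Ha : V a) by (apply Hl; now left).
  assert (Hl' : forall b, In b l -> V b) by (intros; apply Hl; now right).
  rewrite reach_cons in HG. cbn [avgs]. pose proof (INR_L_pos L HL) as HL0.
  destruct Hv as [->|Hv].
  - rewrite !avg_step. pose proof (avgs_up l Hl' _ _ HG) as HH.
    set (H := avgs l L G) in *.
    replace (vsub _ _) with (vscal (/ INR L) (vsub
      (vsub (H (vadd x (vscal (INR L) v))) (H (vadd y (vscal (INR L) v))))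
      (vsub (H x) (H y)))) by vec.
    rewrite vnorm_scal_pos by now apply Rlt_le, Rinv_0_lt_compat.
    assert (H1 : vnorm (vsub (H (vadd x (vscal (INR L) v))) (H (vadd y (vscal (INR L) v))))
                 <= C * (vnorm (vsub x y) + 1)).
    { replace (vsub x y) with (vsub (vadd x (vscal (INR L) v)) (vadd y (vscal (INR L) v))) by vec.
      apply HH; apply dom_step; try easy; split; try lra; apply pos_INR. }
    assert (H2 : vnorm (vsub (H x) (H y)) <= C * (vnorm (vsub x y) + 1)).
    { apply HH; eapply dom_le; try eassumption; pose proof (vnorm_pos v); nra. }
    pose proof (vnorm_le_sub _ (vsub (H (vadd x (vscal (INR L) v))) (H (vadd y (vscal (INR L) v))))
      (vsub (H x) (H y)) eq_refl) as Ht.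
    replace (2 * C / INR L * (vnorm (vsub x y) + 1)) with
      (/ INR L * (2 * (C * (vnorm (vsub x y) + 1)))) by (field; lra).
    apply Rmult_le_compat_l; [now apply Rlt_le, Rinv_0_lt_compat|]. lra.
  - rewrite !avg_diff. apply avg_dist; [easy|]. intros j Hj.
    replace (vsub x y) with (vsub (vadd x (vscal (INR j) a)) (vadd y (vscal (INR j) a))) by vec.
    apply (IH Hl' Hv _ _ HG); now apply dom_step_nat.
Qed.

(** Averages commute, so the one along [a] can be applied to the norms directly. There the triangle
    inequality and [avg_step] leave the increment of [G] over [L] steps, divided by [L], which is at
    least [vnorm a - D / L]. *)
Lemma avgs_telescope l a D : (forall a, In a l -> V a) -> In a l -> forall r G,
  coarse_low V D (r + reach l) G -> forall x, dom V r x ->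
  vnorm a - D / INR L <= avgs (X := Rspace) l L (fun y => vnorm (diff a G y)) x.
Proof.
  intros Hl Ha. induction l as [|b l IH]; [easy|]. intros r G HG x Hx.
  assert (Hb : V b) by (apply Hl; now left).
  assert (Hl' : forall b, In b l -> V b) by (intros; apply Hl; now right).
  rewrite reach_cons in HG. cbn [avgs]. pose proof (INR_L_pos L HL) as HL0.
  destruct Ha as [->|Ha].
  - rewrite avg_avgs_comm.
    rewrite <- (avgs_const L HL l (vnorm a - D / INR L) x).
    apply (avgs_le l Hl' r); [|easy]. intros y Hy.
    eapply Rle_trans; [|apply avg_norm; easy]. rewrite <- avg_diff, avg_step.
    rewrite vnorm_scal_pos by now apply Rlt_le, Rinv_0_lt_compat.
    apply (Rmult_le_reg_l (INR L)); [easy|].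
    rewrite <- (Rmult_assoc (INR L)), Rinv_r, Rmult_1_l by lra.
    replace (INR L * (vnorm a - D / INR L)) with (INR L * vnorm a - D) by (field; lra).
    rewrite <- vnorm_scal_pos by lra.
    replace (vscal (INR L) a) with (vsub (vadd y (vscal (INR L) a)) y) at 1 by vec.
    apply HG.
    + replace (INR L * vnorm a + r + reach l) with (INR L * vnorm a + (r + reach l)) by ring.
      apply dom_step; [easy|lra|easy].
    + eapply dom_le; [|eassumption]. pose proof (vnorm_pos a). nra.
  - rewrite <- (avg_const L HL b (vnorm a - D / INR L : Rspace) x).
    apply avg_le; [easy|]. intros j Hj. apply (IH Hl' Ha _ _ HG). now apply dom_step_nat.
Qed.

End Local.

(** * Linear maps from coarse embeddings *)

Lemma nat_above (r : R) : exists n, (0 < n)%nat /\ r <= INR n.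
Proof.
  destruct (INR_unbounded r) as [n Hn]. exists (S n). split; [lia|]. rewrite S_INR. lra.
Qed.

Section Flat.
Context {E X : NormedSpace} (V : E -> Prop) (HV : subspace V) (l : list E)
  (Hl : forall a, In a l -> V a) (C : R) (HC : 0 <= C).

Definition energy (G : E -> X) (x : E) : R := lsum (fun a => vnorm (diff a G x)) l.

Lemma energy_nonneg G x : 0 <= energy G x.
Proof. apply lsum_nonneg. intros; apply vnorm_pos. Qed.

(** Averaging does not increase the supremum of the energy. Where it decreases it by at most [1],
    every [|diff a G|] is almost its own average, which telescopes along the direction [a]
    to almost [|a|]. *)
Lemma energy_gap L G p r D J : (0 < L)%nat -> D <= INR L ->
  coarse_low V D (r + reach L l) G ->
  (forall x, dom V (r + reach L l) x -> energy G x <= J) -> dom V r p ->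
  J - 1 < energy (avgs l L G) p ->
  forall a, In a l -> vnorm a - 2 <= vnorm (diff a (avgs l L G) p).
Proof.
  intros HL HD Hlow HJ Hp Hgap a Ha.
  assert (Htot : lsum (fun a => avgs (X := Rspace) l L (fun y => vnorm (diff a G y)) p) l <= J).
  { rewrite <- avgs_lsum, <- (avgs_const L HL l J p) by easy.
    now apply (avgs_le V HV L HL l Hl r). }
  assert (Hj : avgs (X := Rspace) l L (fun y => vnorm (diff a G y)) p
               <= vnorm (diff a (avgs l L G) p) + 1).
  { apply (lsum_gap (fun a => vnorm (diff a (avgs l L G) p))
      (fun a => avgs (X := Rspace) l L (fun y => vnorm (diff a G y)) p) l); [|unfold energy in Hgap; lra|easy].
    intros b Hb. rewrite avgs_diff. now apply avgs_norm. }
  pose proof (avgs_telescope V HV L HL l a D Hl Ha r G Hlow p Hp).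
  pose proof (INR_L_pos L HL).
  assert (D / INR L <= 1) by (apply (Rmult_le_reg_r (INR L)); [easy|]; field_simplify; lra).
  lra.
Qed.

(** Induction on the number of unit drops that the energy can still undergo. The radius is
    quantified before [G], since it must be known before an embedding of a large enough ball is
    requested. *)
Lemma exists_flat rho0 delta : 0 <= rho0 -> 0 < delta ->
  forall (j : nat) D, exists r, forall G : E -> X, coarse_up V C r G -> coarse_low V D r G ->
  (forall x, dom V r x -> energy G x <= INR j - 1) ->
  exists (G' : E -> X) p, V p /\
    (forall a, In a l -> vnorm a - 2 <= vnorm (diff a G' p) <= C * (vnorm a + 1)) /\
    (forall a x, In a l -> V x -> vnorm (vsub x p) <= rho0 ->
       vnorm (vsub (diff a G' x) (diff a G' p)) <= delta).
Proof.
  intros Hrho Hdelta j. induction j as [|j IH]; intros D.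
  (* With [j = 0] the energy would be at most [-1]. *)
  { exists 0. intros G _ _ H. specialize (H vzero). pose proof (energy_nonneg G vzero) as H0.
    cbn in H. enough (energy G vzero <= 0 - 1) by lra. apply H. split; [apply HV|].
    rewrite vnorm_vzero. lra. }
  (* The first bound makes the telescoping error [D / L] at most 1; the second makes differences
     vary by at most [delta] at distance [rho0]. *)
  destruct (nat_above (Rmax D (2 * C * (rho0 + 1) / delta))) as (L & HL & HLge).
  pose proof (Rmax_l D (2 * C * (rho0 + 1) / delta)) as HLD.
  pose proof (Rmax_r D (2 * C * (rho0 + 1) / delta)) as HLd.
  pose proof (INR_L_pos L HL) as HL0.
  pose proof (reach_nonneg L l) as Hreach.
  assert (Hls : 0 <= lsum (@vnorm E) l) by (apply lsum_nonneg; intros; apply vnorm_pos).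
  set (D' := D + 2 * (C * (reach L l + INR (length l)))).
  destruct (IH D') as [r1 Hr1]. set (r := Rmax 0 r1).
  assert (Hr0 : 0 <= r) by apply Rmax_l. assert (Hrr : r1 <= r) by apply Rmax_r.
  (* Room for the next stage, for a neighbourhood of [p] of radius [rho0], and for one translation
     by an element of [l]. *)
  set (m := r + rho0 + lsum vnorm l).
  exists (m + reach L l). intros G Hup Hlow HJ.
  pose proof (avgs_up V HV L HL C l Hl m G Hup) as Hup'.
  (* Either the averaged map nearly attains the old bound [INR j] somewhere and is the map sought,
     or its energy has dropped by a unit on the whole ball and the induction applies to it. *)
  destruct (classic (exists p, dom V r p /\ INR j - 1 < energy (avgs l L G) p)) as [(p & Hp & Hgap)|Hno].
  - exists (avgs l L G), p. split; [apply Hp|]. split.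
    + intros a Ha. split.
      * apply (energy_gap L G p r D (INR j)); try easy; try lra.
        -- intros x y Hx Hy. apply Hlow; eapply dom_le; try eassumption; unfold m; lra.
        -- intros x Hx. rewrite S_INR in HJ. enough (energy G x <= INR j + 1 - 1) by lra.
           apply HJ. eapply dom_le; [|eassumption]; unfold m; lra.
      * unfold diff. replace a with (vsub (vadd p a) p) at 2 by vec. apply Hup'.
        -- split; [apply HV; [apply Hp|now apply Hl]|].
           pose proof (vnorm_triangle _ p a). destruct Hp as [_ Hp].
           pose proof (lsum_ge (@vnorm E) l a vnorm_pos Ha). unfold m. lra.
        -- eapply dom_le; [|eassumption]; unfold m; lra.
    + intros a x Ha Hx Hxp.
      eapply Rle_trans; [apply (avgs_smooth V HV L HL C l a Hl Ha m G Hup)|].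
      * split; [easy|]. pose proof (vnorm_le_add x (vsub x p) p ltac:(vec)).
        destruct Hp as [_ Hp]. unfold m. lra.
      * eapply dom_le; [|eassumption]; unfold m; lra.
      * apply (Rmult_le_reg_l (INR L)); [easy|].
        replace (INR L * (2 * C / INR L * (vnorm (vsub x p) + 1)))
          with (2 * C * (vnorm (vsub x p) + 1)) by (field; lra).
        apply Rle_trans with (2 * C * (rho0 + 1)); [apply Rmult_le_compat_l; lra|].
        assert (H : 2 * C * (rho0 + 1) / delta <= INR L) by lra.
        apply (Rmult_le_compat_r delta) in H; [|lra].
        replace (2 * C * (rho0 + 1) / delta * delta) with (2 * C * (rho0 + 1)) in H by (field; lra).
        easy.
  - apply (Hr1 (avgs l L G)).
    + intros x y Hx Hy. apply Hup'; eapply dom_le; try eassumption; unfold m; lra.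
    + intros x y Hx Hy.
      assert (Hx' : dom V m x) by (eapply dom_le; [|eassumption]; unfold m; lra).
      assert (Hy' : dom V m y) by (eapply dom_le; [|eassumption]; unfold m; lra).
      pose proof (avgs_close V HV L HL C HC l Hl m G Hup x Hx').
      pose proof (avgs_close V HV L HL C HC l Hl m G Hup y Hy').
      assert (HH : vnorm (vsub x y) - D <= vnorm (vsub (G x) (G y)))
        by (apply Hlow; eapply dom_le; try eassumption; lra).
      set (A := avgs l L G) in *.
      pose proof (vnorm_le_add (vsub (G x) (G y)) (vsub (G x) (G y)) vzero ltac:(vec)).
      pose proof (vnorm_le_sub (vsub (G x) (G y)) (vsub (A x) (G y)) (vsub (A x) (G x)) ltac:(vec)).
      pose proof (vnorm_le_add (vsub (A x) (G y)) (vsub (A x) (A y)) (vsub (A y) (G y)) ltac:(vec)).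
      unfold D'. lra.
    + intros x Hx. apply Rnot_lt_le. intros Hlt. apply Hno. exists x. split; [|easy].
      eapply dom_le; eassumption.
Qed.

End Flat.

(** The initial energy is at most the sum of [C * (vnorm a + 1)] for every admissible [G], which
    fixes the number of stages. *)
Lemma exists_flat_map {E X : NormedSpace} (V : E -> Prop) (l : list E) (C D rho0 delta : R) :
  subspace V -> (forall a, In a l -> V a) -> 0 <= C -> 0 <= rho0 -> 0 < delta ->
  (forall r, exists G : E -> X, coarse_up V C r G /\ coarse_low V D r G) ->
  exists (G : E -> X) p, V p /\
    (forall a, In a l -> vnorm a - 2 <= vnorm (diff a G p) <= C * (vnorm a + 1)) /\
    (forall a x, In a l -> V x -> vnorm (vsub x p) <= rho0 ->
       vnorm (vsub (diff a G x) (diff a G p)) <= delta).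
Proof.
  intros HV Hl HC Hrho Hdelta HF.
  destruct (nat_above (lsum (fun a => C * (vnorm a + 1)) l + 1)) as (j & _ & Hj).
  destruct (exists_flat (X := X) V HV l Hl C HC rho0 delta Hrho Hdelta j D) as [r Hr].
  destruct (HF (r + lsum vnorm l)) as (G & Hup & Hlow).
  assert (Hls : 0 <= lsum (@vnorm E) l) by (apply lsum_nonneg; intros; apply vnorm_pos).
  apply (Hr G).
  - intros x y Hx Hy. apply Hup; eapply dom_le; try eassumption; lra.
  - intros x y Hx Hy. apply Hlow; eapply dom_le; try eassumption; lra.
  - intros x Hx. apply Rle_trans with (lsum (fun a => C * (vnorm a + 1)) l); [|lra].
    apply lsum_le. intros a Ha. unfold diff.
    replace a with (vsub (vadd x a) x) at 2 by vec. apply Hup.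
    + split; [apply HV; [apply Hx|now apply Hl]|]. destruct Hx as [_ Hx].
      pose proof (vnorm_triangle _ x a). pose proof (lsum_ge (@vnorm E) l a vnorm_pos Ha). lra.
    + eapply dom_le; [|eassumption]; lra.
Qed.

(** * Integer grids and linear extension *)

Definition ilc {X : NormedSpace} (n : nat) (m : nat -> Z) (v : nat -> X) : X :=
  lc n (fun i => IZR (m i)) v.

Lemma grid_list {E : NormedSpace} (S : Z) (v : nat -> E) d : exists l,
  (forall a, In a l -> span d v a) /\
  (forall m, (forall i, (i < d)%nat -> (Z.abs (m i) <= S)%Z) -> In (ilc d m v) l).
Proof.
  induction d as [|d [l [Hl1 Hl2]]].
  - exists (vzero :: nil). split.
    + intros a [<-|[]]. apply span_subspace.
    + intros m _. now left.
  - set (zs := map (fun k => (Z.of_nat k - S)%Z) (seq 0 (Z.to_nat (2 * S + 1)))).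
    exists (flat_map (fun z => map (fun a => vadd a (vscal (IZR z) (v d))) l) zs). split.
    + intros a (z & Hz & Ha)%in_flat_map. apply in_map_iff in Ha as (b & <- & Hb).
      apply span_S. exists b, (IZR z). auto.
    + intros m Hm. apply in_flat_map. exists (m d). split.
      * apply in_map_iff. specialize (Hm d ltac:(lia)). exists (Z.to_nat (m d + S)).
        split; [lia|]. apply in_seq. lia.
      * apply in_map_iff. exists (ilc d m v). split; [easy|]. apply Hl2. intros; apply Hm; lia.
Qed.

(** Rounding towards zero: absolute values do not grow, so rounded coefficients stay in the grid. *)
Definition round0 (c : R) : Z := if Rle_dec 0 c then Int_part c else (- Int_part (- c))%Z.

Lemma round0_spec (c : R) (S : Z) : Rabs c <= IZR S ->
  (Z.abs (round0 c) <= S)%Z /\ Rabs (c - IZR (round0 c)) <= 1.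
Proof.
  assert (H : forall c, 0 <= c -> (0 <= Int_part c)%Z /\ IZR (Int_part c) <= c < IZR (Int_part c) + 1).
  { clear. intros c Hc. destruct (base_Int_part c) as [H1 H2]. split; [|lra].
    apply Z.lt_succ_r, lt_IZR. rewrite succ_IZR. lra. }
  intros HS. unfold round0. destruct (Rle_dec 0 c) as [Hc|Hc].
  - destruct (H c Hc) as [H0 H1]. rewrite (Rabs_pos_eq c) in HS by easy. split.
    + rewrite Z.abs_eq by easy. apply le_IZR. lra.
    + apply Rabs_le. lra.
  - destruct (H (- c) ltac:(lra)) as [H0 H1]. rewrite (Rabs_left c) in HS by lra. split.
    + rewrite Z.abs_opp, Z.abs_eq by easy. apply le_IZR. lra.
    + rewrite opp_IZR. apply Rabs_le. lra.
Qed.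

Definition nsum {X : NormedSpace} (n : nat) (v : nat -> X) : R :=
  @vsum Rspace n (fun i => vnorm (v i)).

Lemma nsum_nonneg {X : NormedSpace} n (v : nat -> X) : 0 <= nsum n v.
Proof.
  induction n as [|n IH]; unfold nsum in *; cbn in *; [lra|]. pose proof (vnorm_pos (v n)). lra.
Qed.

Lemma vnorm_lc_le {X : NormedSpace} n c (v : nat -> X) S :
  (forall i, (i < n)%nat -> Rabs (c i) <= S) -> vnorm (lc n c v) <= S * nsum n v.
Proof.
  intros H. induction n as [|n IH]; [cbn; rewrite vnorm_vzero; lra|].
  specialize (IH (fun i Hi => H i ltac:(lia))). unfold lc, nsum in *. cbn in *.
  pose proof (vnorm_le_add _ (vsum n (fun i => vscal (c i) (v i))) (vscal (c n) (v n)) eq_refl) as Ht.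
  rewrite vnorm_scal in Ht. pose proof (H n ltac:(lia)). pose proof (vnorm_pos (v n)). nra.
Qed.

Lemma nsum_le {X Y : NormedSpace} n k (v : nat -> X) (w : nat -> Y) (C : R) : (n <= k)%nat -> 0 <= C ->
  (forall i, (i < n)%nat -> vnorm (w i) <= C * (vnorm (v i) + 1)) ->
  nsum n w <= C * (nsum k v + INR k).
Proof.
  intros Hnk HC H. induction Hnk as [|k Hnk IH].
  - induction n as [|n IH]; unfold nsum in *; [cbn; lra|]. rewrite S_INR. cbn in *.
    pose proof (H n ltac:(lia)). specialize (IH (fun i Hi => H i ltac:(lia))). lra.
  - unfold nsum in *. rewrite S_INR. cbn in *. pose proof (vnorm_pos (v k)). nra.
Qed.

Lemma nsum_mono {X : NormedSpace} n k (v : nat -> X) : (n <= k)%nat -> nsum n v <= nsum k v.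
Proof.
  induction 1 as [|k _ IH]; [lra|]. unfold nsum in *. cbn in *. pose proof (vnorm_pos (v k)). lra.
Qed.

Section Integers.
Context {E X : NormedSpace} (G : E -> X) (delta : R).

Lemma int_step (v q : E) (t : X) (S : Z) (m : Z) : 0 <= delta -> (Z.abs m <= S)%Z ->
  (forall th, Rabs th <= IZR S -> vnorm (vsub (diff v G (vadd q (vscal th v))) t) <= delta) ->
  vnorm (vsub (vsub (G (vadd q (vscal (IZR m) v))) (G q)) (vscal (IZR m) t)) <= IZR S * delta.
Proof.
  intros Hd Hm H.
  assert (Hk : forall k : nat, (Z.of_nat k <= S)%Z ->
    vnorm (vsub (vsub (G (vadd q (vscal (INR k) v))) (G q)) (vscal (INR k) t)) <= INR k * delta /\
    vnorm (vsub (vsub (G (vadd q (vscal (- INR k) v))) (G q)) (vscal (- INR k) t)) <= INR k * delta).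
  { induction k as [|k IH]; intros Hk.
    - cbn. rewrite Ropp_0. replace (vadd q (vscal 0 v)) with q by vec.
      replace (vsub _ _) with (@vzero X) by vec. rewrite vnorm_vzero. lra.
    - destruct (IH ltac:(lia)) as [IH1 IH2].
      assert (HkS : INR k + 1 <= IZR S) by (rewrite INR_IZR_INZ, <- succ_IZR; apply IZR_le; lia).
      pose proof (pos_INR k) as Hk0. rewrite S_INR. split.
      + specialize (H (INR k)). rewrite Rabs_pos_eq in H by easy. specialize (H ltac:(lra)).
        unfold diff in H.
        replace (vadd (vadd q (vscal (INR k) v)) v) with (vadd q (vscal (INR k + 1) v)) in H by vec.
        match type of IH1 with vnorm ?a <= _ => match type of H with vnorm ?b <= _ =>
          match goal with |- vnorm ?c <= _ => pose proof (vnorm_le_add c a b ltac:(vec)) end end end.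
        lra.
      (* The backward step from [-k] to [-(k+1)] is a forward difference based at its far end. *)
      + specialize (H (- (INR k + 1))). rewrite Rabs_Ropp, Rabs_pos_eq in H by lra.
        specialize (H ltac:(lra)). unfold diff in H.
        replace (vadd (vadd q (vscal (- (INR k + 1)) v)) v) with (vadd q (vscal (- INR k) v)) in H by vec.
        match type of IH2 with vnorm ?a <= _ => match type of H with vnorm ?b <= _ =>
          match goal with |- vnorm ?c <= _ => pose proof (vnorm_le_sub c a b ltac:(vec)) end end end.
        lra. }
  assert (Hb : forall k : nat, (Z.of_nat k <= S)%Z -> INR k * delta <= IZR S * delta).
  { intros k HkS. apply Rmult_le_compat_r; [easy|]. rewrite INR_IZR_INZ. now apply IZR_le. }
  destruct (Z.le_gt_cases 0 m) as [Hm0|Hm0].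
  - specialize (Hk (Z.to_nat m) ltac:(lia)). specialize (Hb (Z.to_nat m) ltac:(lia)).
    rewrite INR_IZR_INZ, Z2Nat.id in * by lia. lra.
  - specialize (Hk (Z.to_nat (- m)) ltac:(lia)). specialize (Hb (Z.to_nat (- m)) ltac:(lia)).
    rewrite INR_IZR_INZ, Z2Nat.id, opp_IZR, Ropp_involutive in * by lia. lra.
Qed.

(** The grid point is reached one coordinate at a time; the path stays within [S * nsum d v] of [p],
    where the differences are nearly constant. *)
Lemma int_lc (v : nat -> E) (t : nat -> X) (p : E) (S : Z) (m : nat -> Z) d :
  0 <= delta -> (0 <= S)%Z -> (forall i, (i < d)%nat -> (Z.abs (m i) <= S)%Z) ->
  (forall i w, (i < d)%nat -> span d v w -> vnorm w <= IZR S * nsum d v ->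
     vnorm (vsub (diff (v i) G (vadd p w)) (t i)) <= delta) ->
  forall n, (n <= d)%nat ->
  vnorm (vsub (vsub (G (vadd p (ilc n m v))) (G p)) (ilc n m t)) <= INR n * (IZR S * delta).
Proof.
  intros Hd HS Hm H. induction n as [|n IH]; intros Hn.
  - unfold ilc. cbn. replace (vadd p vzero) with p by vec.
    replace (vsub _ _) with (@vzero X) by vec. rewrite vnorm_vzero. lra.
  - specialize (IH ltac:(lia)). rewrite S_INR.
    pose proof (int_step (v n) (vadd p (ilc n m v)) (t n) S (m n) Hd (Hm n ltac:(lia))) as Hs.
    match type of Hs with ?A -> _ => assert (HA : A) end.
    { intros th Hth. rewrite <- vadd_assoc.
      set (c i := if Nat.eqb i n then th else IZR (m i)).
      assert (Hc : vadd (ilc n m v) (vscal th (v n)) = lc (Datatypes.S n) c v)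
        by (unfold c; now rewrite lc_extend).
      rewrite Hc. apply H; [lia| |].
      (* The combination of the first [n + 1] vectors is padded with zeros to length [d]. *)
      - exists (fun i => if Nat.ltb i (Datatypes.S n) then c i else 0).
        clear - Hn. induction Hn as [|k Hn IH].
        + apply lc_ext. intros i Hi. destruct (Nat.ltb_spec i (Datatypes.S n)); [easy|lia].
        + rewrite IH. unfold lc. cbn [vsum]. destruct (Nat.ltb_spec k (Datatypes.S n)); [lia|]. vec.
      - eapply Rle_trans; [apply (vnorm_lc_le _ _ _ (IZR S))|].
        + intros i Hi. unfold c. destruct (Nat.eqb_spec i n); [easy|].
          rewrite <- abs_IZR. apply IZR_le, Hm. lia.
        + apply Rmult_le_compat_l; [now apply IZR_le|]. now apply nsum_mono. }
    specialize (Hs HA). unfold ilc, lc in *. cbn [vsum].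
    rewrite vadd_assoc.
    match type of IH with vnorm ?a <= _ => match type of Hs with vnorm ?b <= _ =>
      match goal with |- vnorm ?c <= _ => pose proof (vnorm_le_add c a b ltac:(vec)) end end end.
    lra.
Qed.

End Integers.

(** On a sphere so large that all additive errors are at most half its radius, the linear extension
    of the differences inherits the bounds known at grid points; homogeneity gives them everywhere.
    The constants [1/2] and [3 * C] are free of [d] and [D]. *)
Lemma exists_linear_map {E X : NormedSpace} (V : E -> Prop) (v : nat -> E) (d : nat) (k C D : R) :
  (forall x, V x <-> span d v x) -> 0 < k ->
  (forall c i, (i < d)%nat -> k * Rabs (c i) <= vnorm (lc d c v)) -> 1 <= C ->
  (forall r, exists G : E -> X, coarse_up V C r G /\ coarse_low V D r G) ->
  exists T : E -> X, linear_on V T /\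
    forall x, V x -> / 2 * vnorm x <= vnorm (T x) <= 3 * C * vnorm x.
Proof.
  intros HVs Hk Hcoord HC HF.
  assert (HV : subspace V).
  { destruct (span_subspace d v) as (H0 & H1 & H2). split; [|split].
    - now apply HVs.
    - intros x y Hx Hy. apply HVs in Hx, Hy. now apply HVs, H1.
    - intros a x Hx. apply HVs in Hx. now apply HVs, H2. }
  set (B := nsum d v). assert (HB : 0 <= B) by apply nsum_nonneg.
  set (Q := C * (B + INR d)).
  assert (HQ : 0 <= Q) by (apply Rmult_le_pos; [lra|]; pose proof (pos_INR d); lra).
  (* The errors to absorb: [B] and [Q] from rounding in [E] and in [X], 2 from the lower bound at
     grid points, 1 from the failure of additivity. *)
  destruct (nat_above (2 * (B + 3 + Q) / k)) as (s & Hs0 & Hs).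
  assert (HkS : 2 * (B + 3 + Q) <= k * INR s).
  { apply (Rmult_le_compat_r k) in Hs; [|lra].
    replace (2 * (B + 3 + Q) / k * k) with (2 * (B + 3 + Q)) in Hs by (field; lra). lra. }
  clear Hs. set (S := Z.of_nat s). assert (HSs : IZR S = INR s) by (unfold S; now rewrite INR_IZR_INZ).
  assert (HS1 : 1 <= INR s) by (apply (le_INR 1); lia). rewrite <- HSs in *.
  destruct (grid_list S v d) as (l0 & Hl0 & Hgrid).
  (* The grid points carry the norm bounds; the basis vectors carry the near constancy that yields
     additivity. *)
  set (l := l0 ++ map v (seq 0 d)).
  assert (Hl : forall a, In a l -> V a).
  { intros a [Ha|Ha]%in_app_iff; apply HVs; [now apply Hl0|].
    apply in_map_iff in Ha as (i & <- & Hi). apply in_seq in Hi.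
    eexists. symmetry. apply lc_delta. lia. }
  assert (Hlv : forall i, (i < d)%nat -> In (v i) l).
  { intros i Hi. apply in_app_iff. right. apply in_map, in_seq. lia. }
  pose proof (pos_INR d) as Hd0.
  (* A grid point is reached in at most [d * S] unit steps, so the total deviation stays below 1. *)
  set (delta := / (INR d * IZR S + 1)).
  assert (Hden : 0 < INR d * IZR S + 1) by (assert (0 <= INR d * IZR S) by (apply Rmult_le_pos; lra); lra).
  assert (Hdelta : 0 < delta) by now apply Rinv_0_lt_compat.
  destruct (exists_flat_map (X := X) V l C D (IZR S * B) delta HV Hl ltac:(lra)
    ltac:(apply Rmult_le_pos; lra) Hdelta HF) as (G & p & Hp & HG & Hsm).
  set (t i := diff (v i) G p).
  assert (HtQ : nsum d t <= Q).
  { apply nsum_le; [lia|lra|]. intros i Hi. apply HG. now apply Hlv. }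
  assert (Hint : forall m, (forall i, (i < d)%nat -> (Z.abs (m i) <= S)%Z) ->
    vnorm (vsub (diff (ilc d m v) G p) (ilc d m t)) <= 1).
  { intros m Hm. eapply Rle_trans; [apply (int_lc G delta v t p S m d); try lra; try easy|].
    - unfold S. lia.
    - intros i w Hi Hw Hwn. apply Hsm; [now apply Hlv|apply HV; [easy|now apply HVs]|].
      replace (vsub (vadd p w) p) with w by vec. easy.
    - unfold delta. apply (Rmult_le_reg_r (INR d * IZR S + 1)); [easy|].
      replace (INR d * (IZR S * / (INR d * IZR S + 1)) * (INR d * IZR S + 1))
        with (INR d * IZR S) by (field; lra). lra. }
  (* On this sphere [Hcoord] bounds the coordinates by [S], the size of the grid. *)
  assert (Hbound : forall c, vnorm (lc d c v) = k * IZR S ->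
    / 2 * vnorm (lc d c v) <= vnorm (lc d c t) <= 3 * C * vnorm (lc d c v)).
  { intros c Hc. set (m i := round0 (c i)).
    assert (Hm : forall i, (i < d)%nat -> (Z.abs (m i) <= S)%Z /\ Rabs (c i - IZR (m i)) <= 1).
    { intros i Hi. apply round0_spec. apply (Rmult_le_reg_l k); [easy|]. rewrite <- Hc. now apply Hcoord. }
    pose proof (Hint m (fun i Hi => proj1 (Hm i Hi))) as H1.
    pose proof (HG (ilc d m v)) as H2. specialize (H2 ltac:(apply in_app_iff; left; apply Hgrid; apply Hm)).
    assert (H3 : vnorm (vsub (lc d c v) (ilc d m v)) <= 1 * B).
    { unfold ilc. rewrite <- lc_sub. apply vnorm_lc_le. apply Hm. }
    assert (H4 : vnorm (vsub (lc d c t) (ilc d m t)) <= 1 * nsum d t).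
    { unfold ilc. rewrite <- lc_sub. apply vnorm_lc_le. apply Hm. }
    pose proof (vnorm_le_add (lc d c v) (vsub (lc d c v) (ilc d m v)) (ilc d m v) ltac:(vec)).
    pose proof (vnorm_le_sub (ilc d m v) (lc d c v) (vsub (lc d c v) (ilc d m v)) ltac:(vec)).
    pose proof (vnorm_le_add (lc d c t) (vsub (lc d c t) (ilc d m t)) (ilc d m t) ltac:(vec)).
    pose proof (vnorm_le_sub (ilc d m t) (lc d c t) (vsub (lc d c t) (ilc d m t)) ltac:(vec)).
    pose proof (vnorm_le_sub (ilc d m t) (diff (ilc d m v) G p)
      (vsub (diff (ilc d m v) G p) (ilc d m t)) ltac:(vec)).
    pose proof (vnorm_le_add (diff (ilc d m v) G p) (ilc d m t)
      (vsub (diff (ilc d m v) G p) (ilc d m t)) ltac:(vec)).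
    split; [lra|].
    assert (Hup : vnorm (lc d c t) <= C * (vnorm (lc d c v) + B + 1) + 1 + Q).
    { assert (C * (vnorm (ilc d m v) + 1) <= C * (vnorm (lc d c v) + B + 1)); [|lra].
      apply Rmult_le_compat_l; lra. }
    assert (1 + Q <= C * (1 + Q)) by nra.
    assert (C * (B + 2 + Q) <= C * vnorm (lc d c v)) by (apply Rmult_le_compat_l; lra). lra. }
  assert (Hbound' : forall c, / 2 * vnorm (lc d c v) <= vnorm (lc d c t) <= 3 * C * vnorm (lc d c v)).
  { intros c. destruct (Rle_lt_or_eq_dec 0 (vnorm (lc d c v)) (vnorm_pos _)) as [Hpos|H0].
    - set (a := k * IZR S / vnorm (lc d c v)).
      assert (Ha : 0 < a) by (apply Rdiv_lt_0_compat; [apply Rmult_lt_0_compat|]; lra).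
      specialize (Hbound (fun i => a * c i)). rewrite !lc_scal, !vnorm_scal_pos in Hbound by lra.
      assert (He : a * vnorm (lc d c v) = k * IZR S) by (unfold a; field; lra).
      destruct (Hbound He) as [H1 H2]. split; apply (Rmult_le_reg_l a); lra.
    - assert (Hc0 : forall i, (i < d)%nat -> Rabs (c i) <= 0).
      { intros i Hi. apply (Rmult_le_reg_l k); [easy|]. specialize (Hcoord c i Hi). lra. }
      pose proof (vnorm_lc_le d c t 0 Hc0). pose proof (vnorm_pos (lc d c t)).
      rewrite <- H0. lra. }
  set (co x := epsilon (inhabits (fun _ : nat => 0)) (fun c => x = lc d c v)).
  assert (Hco : forall x, V x -> x = lc d (co x) v) by (intros x Hx; now apply epsilon_spec, HVs).
  assert (Huniq : forall c c', lc d c v = lc d c' v -> lc d c t = lc d c' t).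
  { intros c c' He. apply vsub_norm_0. rewrite <- lc_sub.
    pose proof (Hbound' (fun i => c i - c' i)) as [_ H]. rewrite !lc_sub, He, vsub_self in H.
    rewrite lc_sub. pose proof (vnorm_pos (vsub (lc d c t) (lc d c' t))). lra. }
  exists (fun x => lc d (co x) t). split; [split|].
  - intros x y Hx Hy. rewrite <- lc_add. apply Huniq.
    rewrite lc_add, <- !Hco; try easy. now apply HV.
  - intros a x Hx. rewrite <- lc_scal. apply Huniq. rewrite lc_scal, <- !Hco; try easy. now apply HV.
  - intros x Hx. rewrite (Hco x Hx) at 1 4. apply Hbound'.
Qed.

(** * The graph *)

Lemma nat_ceil (a : R) : 0 <= a -> exists m, a <= INR m <= a + 1.
Proof.
  intros Ha. destruct (archimed a) as [H1 H2]. exists (Z.to_nat (up a)).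
  rewrite INR_IZR_INZ, Z2Nat.id; [lra|]. apply le_IZR. lra.
Qed.

(** * Separated nets of balls *)

Definition separated_net {E : NormedSpace} (P M : E -> Prop) : Prop :=
  (forall x, M x -> P x) /\
  (forall x y, M x -> M y -> x <> y -> 1 <= vnorm (vsub x y)) /\
  (forall x, P x -> exists y, M y /\ vnorm (vsub x y) <= 1).

(** Each centre in [l] contributes at most one new point: two points within [1/2] of the same centre
    are within 1 of each other. A net is thus completed in finitely many choices. *)
Lemma greedy_net {E : NormedSpace} (P : E -> Prop) (l M0 : list E) :
  (forall x, In x M0 -> P x) ->
  (forall x y, In x M0 -> In y M0 -> x <> y -> 1 <= vnorm (vsub x y)) ->
  exists M, (forall x, In x M0 -> In x M) /\ (forall x, In x M -> P x) /\
    (forall x y, In x M -> In y M -> x <> y -> 1 <= vnorm (vsub x y)) /\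
    (forall x a, P x -> In a l -> vnorm (vsub x a) < / 2 ->
       exists y, In y M /\ vnorm (vsub x y) <= 1).
Proof.
  intros HP Hs. induction l as [|c l (M & H0 & H1 & H2 & H3)].
  { exists M0. repeat split; easy. }
  destruct (classic (exists x, P x /\ vnorm (vsub x c) < / 2 /\
                       forall y, In y M -> 1 <= vnorm (vsub x y))) as [(x & Hx & Hxc & Hxs)|Hno].
  - exists (x :: M). split; [|split; [|split]].
    + intros y Hy. right. auto.
    + intros y [<-|Hy]; auto.
    + intros y z [<-|Hy] [<-|Hz] Hyz; auto; [easy|]. rewrite vnorm_sub_sym. auto.
    + intros y a Hy [<-|Ha] Hya.
      * exists x. split; [now left|].
        pose proof (vnorm_le_sub (vsub y x) (vsub y c) (vsub x c) ltac:(vec)). lra.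
      * destruct (H3 y a Hy Ha Hya) as (z & Hz & Hyz). exists z. split; [now right|easy].
  - exists M. split; [|split; [|split]]; try easy.
    intros x a Hx [<-|Ha] Hxa; [|now apply (H3 x a)].
    apply NNPP. intros Hn. apply Hno. exists x. split; [easy|]. split; [easy|].
    intros y Hy. apply Rnot_lt_le. intros Hlt. apply Hn. exists y. split; [easy|lra].
Qed.

Lemma exists_separated_net {E : NormedSpace} (d : nat) (v : nat -> E) (k r : R) :
  0 < k -> 0 <= r -> (forall c i, (i < d)%nat -> k * Rabs (c i) <= vnorm (lc d c v)) ->
  exists M, M vzero /\ separated_net (dom (span d v) r) M.
Proof.
  intros Hk Hr Hcoord. set (B := nsum d v). assert (HB : 0 <= B) by apply nsum_nonneg.
  (* Shrinking the basis brings the rounding error [nsum d w] below [1/2], as [greedy_net] requires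
     of its centres. *)
  set (b := 2 * B + 1). set (w i := vscal (/ b) (v i)).
  assert (Hlc : forall c, lc d c v = lc d (fun i => b * c i) w).
  { intros c. apply vsum_ext. intros i _. unfold w. assert (b <> 0) by (unfold b; lra). vec. }
  assert (Hw : nsum d w < / 2).
  { assert (He : nsum d w = / b * B).
    { unfold B, nsum. rewrite <- (vsum_scal (X := Rspace)). apply (vsum_ext (X := Rspace)). intros i _. unfold w.
      rewrite vnorm_scal_pos; [easy|]. apply Rlt_le, Rinv_0_lt_compat. unfold b; lra. }
    rewrite He. apply (Rmult_lt_reg_l b); [unfold b; lra|].
    rewrite <- Rmult_assoc, Rinv_r by (unfold b; lra). unfold b. lra. }
  destruct (nat_above (b * (r / k))) as (s & _ & Hs).
  destruct (grid_list (Z.of_nat s) w d) as (l & _ & Hl).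
  destruct (greedy_net (dom (span d v) r) l (vzero :: nil)) as (M & H0 & H1 & H2 & H3).
  - intros x [<-|[]]. split; [apply span_subspace|]. rewrite vnorm_vzero. lra.
  - intros x y [<-|[]] [<-|[]]. easy.
  - exists (fun x => In x M). split; [apply H0; now left|]. split; [easy|]. split; [easy|].
    intros x [[c ->] Hxr]. set (m i := round0 (b * c i)).
    assert (Hm : forall i, (i < d)%nat -> (Z.abs (m i) <= Z.of_nat s)%Z /\ Rabs (b * c i - IZR (m i)) <= 1).
    { intros i Hi. apply round0_spec. rewrite <- INR_IZR_INZ.
      apply Rle_trans with (2 := Hs). rewrite Rabs_mult, (Rabs_pos_eq b) by (unfold b; lra).
      apply Rmult_le_compat_l; [unfold b; lra|]. apply (Rmult_le_reg_l k); [easy|].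
      replace (k * (r / k)) with r by (field; lra). specialize (Hcoord c i Hi). lra. }
    apply (H3 _ (ilc d m w)); [split; [now exists c|easy]|apply Hl; apply Hm|].
    rewrite Hlc. unfold ilc. rewrite <- lc_sub.
    apply Rle_lt_trans with (1 * nsum d w); [|lra]. apply vnorm_lc_le. apply Hm.
Qed.

Lemma gdist_exists {V : Type} (adj : V -> V -> Prop) u v n : walk adj u v n ->
  exists m, gdist adj u v m.
Proof.
  intros H. destruct (dec_inh_nat_subset_has_unique_least_element (walk adj u v)
    (fun m => classic _) (ex_intro _ n H)) as (m & Hm & _).
  exists m. apply Hm.
Qed.

Lemma walk_app {V : Type} (adj : V -> V -> Prop) u v w n m :
  walk adj u v n -> walk adj v w m -> walk adj u w (n + m).
Proof.
  induction 1 as [|u u' v n Huv _ IH]; intros Hw; [easy|]. cbn. eapply walkS; [eassumption|auto].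
Qed.

Lemma walk_lipschitz {V : Type} {X : NormedSpace} (adj : V -> V -> Prop) (f : V -> X) (B : R) :
  (forall u v, adj u v -> vnorm (vsub (f u) (f v)) <= B) ->
  forall u v n, walk adj u v n -> vnorm (vsub (f u) (f v)) <= B * INR n.
Proof.
  intros HB u v n H. induction H as [v|u w v n Huw _ IH].
  - rewrite vsub_self. cbn. lra.
  - rewrite S_INR. specialize (HB u w Huw).
    pose proof (vnorm_le_add (vsub (f u) (f v)) (vsub (f u) (f w)) (vsub (f w) (f v)) ltac:(vec)). lra.
Qed.

(** * Nets along a ray *)

Section Graph.
Context {E : NormedSpace} (Y : nat -> E -> Prop) (rad : nat -> nat) (M : nat -> E -> Prop).
Context (HY : forall t, subspace (Y t)) (HM0 : forall t, M t vzero)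
  (HM : forall t, separated_net (dom (Y t) (INR (rad t))) (M t)).

Definition vertex : Type := {p : nat * E | M (fst p) (snd p)}.

Definition level (u : vertex) : nat := fst (proj1_sig u).
Definition point (u : vertex) : E := snd (proj1_sig u).

(** The threshold 3 is [1 + 1 + 1]: net points shadowing two points at distance at most 1 are equal
    or adjacent. The ray runs through the zeros of the levels. *)
Definition edge (u v : vertex) : Prop :=
  (level u = level v /\ point u <> point v /\ vnorm (vsub (point u) (point v)) <= 3) \/
  (point u = vzero /\ point v = vzero /\ (level u = S (level v) \/ level v = S (level u))).

Definition mk (t : nat) (x : E) (H : M t x) : vertex := exist _ (t, x) H.

Lemma mk_eq t x y (Hx : M t x) (Hy : M t y) : x = y -> mk t x Hx = mk t y Hy.
Proof. intros ->. unfold mk. f_equal. apply proof_irrelevance. Qed.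

Lemma edge_simple : simple_graph edge.
Proof.
  split.
  - intros u v [(H1 & H2 & H3)|(H1 & H2 & H3)].
    + left. rewrite vnorm_sub_sym. auto.
    + right. tauto.
  - intros v [(H1 & H2 & H3)|(H1 & H2 & H3)]; [easy|lia].
Qed.

Lemma step_walk t x y (Hx : M t x) (Hy : M t y) : vnorm (vsub x y) <= 3 ->
  exists k, (k <= 1)%nat /\ walk edge (mk t x Hx) (mk t y Hy) k.
Proof.
  intros H. destruct (classic (x = y)) as [He|He].
  - exists O. split; [lia|]. rewrite (mk_eq t x y Hx Hy He). constructor.
  - exists 1%nat. split; [lia|]. apply walkS with (mk t y Hy); [|constructor]. now left.
Qed.

(** The point [z] moves along the segment to [y], inside the ball by convexity, and net points
    shadow it. Carrying [z] besides its shadow [x] prevents the approximation errors from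
    accumulating. *)
Lemma chain_walk t y (Hy : M t y) : forall m x (Hx : M t x) z,
  dom (Y t) (INR (rad t)) z -> vnorm (vsub x z) <= 1 -> vnorm (vsub z y) <= INR m ->
  exists k, (k <= S m)%nat /\ walk edge (mk t x Hx) (mk t y Hy) k.
Proof.
  destruct (HM t) as (HM1 & _ & HM3).
  induction m as [|m IH]; intros x Hx z Hz Hxz Hzy.
  - destruct (step_walk t x y Hx Hy) as (k & Hk & Hw).
    + cbn in Hzy. pose proof (vnorm_le_add (vsub x y) (vsub x z) (vsub z y) ltac:(vec)). lra.
    + exists k. split; [lia|easy].
  - rewrite S_INR in Hzy. pose proof (pos_INR m) as Hm.
    set (c := / (INR m + 1)).
    assert (Hc : 0 < c) by (apply Rinv_0_lt_compat; lra).
    assert (Hcm : c * (INR m + 1) = 1) by (unfold c; field; lra).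
    set (z' := vadd (vscal (1 - c) z) (vscal c y)).
    assert (Hc1 : c <= 1) by nra.
    assert (Hz' : dom (Y t) (INR (rad t)) z').
    { destruct (HM1 y Hy) as [Hy1 Hy2]. destruct Hz as [Hz1 Hz2]. split.
      - apply HY; now apply HY.
      - pose proof (vnorm_le_add z' _ _ eq_refl) as H. rewrite !vnorm_scal_pos in H by lra. nra. }
    destruct (HM3 z' Hz') as (x' & Hx' & Hzx').
    assert (Hzz : vnorm (vsub z z') <= 1).
    { replace (vsub z z') with (vscal c (vsub z y)) by (unfold z'; vec).
      rewrite vnorm_scal_pos by lra. nra. }
    destruct (IH x' Hx' z' Hz') as (k & Hk & Hw).
    + now rewrite vnorm_sub_sym.
    + replace (vsub z' y) with (vscal (1 - c) (vsub z y)) by (unfold z'; vec).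
      rewrite vnorm_scal_pos by lra. pose proof (vnorm_pos (vsub z y)). nra.
    + destruct (step_walk t x x' Hx Hx') as (j & Hj & Hw').
      * pose proof (vnorm_le_add (vsub x x') (vsub x z) (vsub z x') ltac:(vec)).
        pose proof (vnorm_le_add (vsub z x') (vsub z z') (vsub z' x') ltac:(vec)). lra.
      * exists (j + k)%nat. split; [lia|]. eapply walk_app; eassumption.
Qed.

(** The bound with slope 1 comes from [chain_walk]; since distinct net points are at distance at
    least 1, it implies the purely multiplicative one, which bilipschitz estimates need. *)
Lemma level_walk t x y (Hx : M t x) (Hy : M t y) :
  exists k, INR k <= 3 * vnorm (vsub x y) /\ INR k <= vnorm (vsub x y) + 2 /\
    walk edge (mk t x Hx) (mk t y Hy) k.
Proof.
  destruct (HM t) as (HM1 & HM2 & _). destruct (classic (x = y)) as [He|He].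
  - exists O. pose proof (vnorm_pos (vsub x y)). cbn. split; [lra|]. split; [lra|].
    rewrite (mk_eq t x y Hx Hy He). constructor.
  - specialize (HM2 x y Hx Hy He).
    destruct (nat_ceil (vnorm (vsub x y)) (vnorm_pos _)) as (m & Hm1 & Hm2).
    destruct (chain_walk t y Hy m x Hx x (HM1 x Hx)) as (k & Hk & Hw).
    + rewrite vsub_self. lra.
    + easy.
    + apply le_INR in Hk. rewrite S_INR in Hk. exists k. split; [lra|]. split; [lra|easy].
Qed.

(** With truncated subtraction this length is [|t - s|]. *)
Lemma ray_walk t s : walk edge (mk t vzero (HM0 t)) (mk s vzero (HM0 s)) ((t - s) + (s - t)).
Proof.
  assert (Hup : forall k t, walk edge (mk t vzero (HM0 t)) (mk (t + k) vzero (HM0 (t + k))) k).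
  { induction k as [|k IH]; intros t'.
    - rewrite Nat.add_0_r. constructor.
    - rewrite <- Nat.add_succ_comm. apply walkS with (mk (S t') vzero (HM0 (S t'))); [|apply IH].
      right. cbn. auto. }
  assert (Hdown : forall k t, walk edge (mk (t + k) vzero (HM0 (t + k))) (mk t vzero (HM0 t)) k).
  { induction k as [|k IH]; intros t'.
    - rewrite Nat.add_0_r. constructor.
    - apply walkS with (mk (t' + k) vzero (HM0 (t' + k))); [|apply IH].
      right. cbn. split; [easy|]. split; [easy|]. left. lia. }
  destruct (Nat.le_ge_cases t s) as [H|H].
  - replace (t - s + (s - t))%nat with (s - t)%nat by lia.
    pose proof (Hup (s - t)%nat t) as Hw. now replace (t + (s - t))%nat with s in Hw by lia.
  - replace (t - s + (s - t))%nat with (t - s)%nat by lia.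
    pose proof (Hdown (t - s)%nat s) as Hw. now replace (s + (t - s))%nat with t in Hw by lia.
Qed.

Lemma far_walk t s x y (Hx : M t x) (Hy : M s y) :
  exists k, INR k <= 3 * vnorm x + Rabs (INR t - INR s) + 3 * vnorm y /\
    walk edge (mk t x Hx) (mk s y Hy) k.
Proof.
  destruct (level_walk t x vzero Hx (HM0 t)) as (k1 & Hk1 & _ & Hw1).
  destruct (level_walk s vzero y (HM0 s) Hy) as (k2 & Hk2 & _ & Hw2).
  exists (k1 + ((t - s + (s - t)) + k2))%nat. split.
  - rewrite !plus_INR. rewrite vnorm_sub_sym in Hk2.
    replace (vsub x vzero) with x in Hk1 by vec. replace (vsub y vzero) with y in Hk2 by vec.
    assert (INR (t - s) + INR (s - t) = Rabs (INR t - INR s)); [|lra].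
    destruct (Nat.le_ge_cases t s) as [H|H].
    + pose proof (le_INR _ _ H). replace (t - s)%nat with O by lia. rewrite minus_INR by easy.
      rewrite Rabs_left1 by lra. cbn. lra.
    + pose proof (le_INR _ _ H). replace (s - t)%nat with O by lia. rewrite minus_INR by easy.
      rewrite Rabs_pos_eq by lra. cbn. lra.
  - eapply walk_app; [eassumption|]. eapply walk_app; [apply ray_walk|easy].
Qed.

Lemma vertex_mk (u : vertex) : exists t x H, u = mk t x H.
Proof. destruct u as [[t x] H]. now exists t, x, H. Qed.

Lemma edge_connected : connected edge.
Proof.
  intros u v. destruct (vertex_mk u) as (t & x & Hx & ->). destruct (vertex_mk v) as (s & y & Hy & ->).
  destruct (far_walk t s x y Hx Hy) as (k & _ & H). now exists k.
Qed.

Lemma vertex_infinite : infinite_type vertex.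
Proof.
  intros [l Hl]. assert (Hb : forall u, In u l -> (level u <= list_max (map level l))%nat).
  { intros u Hu. pose proof (proj1 (list_max_le (map level l) _) (Nat.le_refl _)) as H.
    rewrite Forall_forall in H. apply H. now apply in_map. }
  specialize (Hb _ (Hl (mk (S (list_max (map level l))) vzero (HM0 _)))). cbn in Hb. lia.
Qed.

(** Collapsing every other level to zero is 3-Lipschitz, so detours along the ray create no
    shortcuts. *)
Lemma level_dist t x y (Hx : M t x) (Hy : M t y) n : gdist edge (mk t x Hx) (mk t y Hy) n ->
  vnorm (vsub x y) <= 3 * INR n.
Proof.
  intros [Hw _]. set (f u := if Nat.eqb (level u) t then point u else vzero).
  assert (Hf : forall u v, edge u v -> vnorm (vsub (f u) (f v)) <= 3).
  { intros u v H. unfold f.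
    destruct H as [(H1 & H2 & H3)|(H1 & H2 & H3)].
    - rewrite <- H1. destruct (Nat.eqb (level u) t); [easy|]. rewrite vsub_self. lra.
    - rewrite H1, H2.
      destruct (Nat.eqb (level u) t), (Nat.eqb (level v) t); rewrite vsub_self; lra. }
  pose proof (walk_lipschitz edge f 3 Hf _ _ _ Hw) as H. unfold f in H. cbn in H.
  now rewrite !Nat.eqb_refl in H.
Qed.

Lemma level_dist_up t x y (Hx : M t x) (Hy : M t y) n : gdist edge (mk t x Hx) (mk t y Hy) n ->
  INR n <= 3 * vnorm (vsub x y) /\ INR n <= vnorm (vsub x y) + 2.
Proof.
  intros [_ Hmin]. destruct (level_walk t x y Hx Hy) as (k & H1 & H2 & Hw).
  apply Hmin, le_INR in Hw. lra.
Qed.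

Lemma far_dist t s x y (Hx : M t x) (Hy : M s y) n : gdist edge (mk t x Hx) (mk s y Hy) n ->
  INR n <= 3 * vnorm x + Rabs (INR t - INR s) + 3 * vnorm y.
Proof.
  intros [_ Hmin]. destruct (far_walk t s x y Hx Hy) as (k & H1 & Hw).
  apply Hmin, le_INR in Hw. lra.
Qed.

(** Composing an embedding of the graph with the nearest point map of a ball of [Y t] onto its net
    gives the coarse embeddings of large balls required by [exists_linear_map]. *)
Lemma bilip_coarse (X : NormedSpace) (V : E -> Prop) (f : vertex -> X) (r C : R) : 0 < r ->
  (forall u v n, gdist edge u v n ->
     r * INR n <= vnorm (vsub (f u) (f v)) <= r * C * INR n) ->
  (forall a, exists t, a <= INR (rad t) /\ forall x, V x -> Y t x) ->
  forall a, exists G : E -> X, coarse_up V (12 * Rabs C) a G /\ coarse_low V 2 a G.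
Proof.
  intros Hr Hf Hrad a. destruct (Hrad a) as (t & Hta & HVt).
  assert (Hnear : forall x, exists y, M t y /\
      (dom (Y t) (INR (rad t)) x -> vnorm (vsub x y) <= 1)).
  { intros x. destruct (classic (dom (Y t) (INR (rad t)) x)) as [H|H].
    - destruct (HM t) as (_ & _ & H3). destruct (H3 x H) as (y & Hy & Hxy). now exists y.
    - exists vzero. split; [apply HM0|easy]. }
  set (near x := constructive_indefinite_description _ (Hnear x)).
  set (pt x := mk t (proj1_sig (near x)) (proj1 (proj2_sig (near x)))).
  set (q x := proj1_sig (near x)).
  assert (Hq : forall x, dom V a x -> vnorm (vsub x (q x)) <= 1).
  { intros x [Hx Hxa]. apply (proj2_sig (near x)). split; [now apply HVt|lra]. }
  (* The factor [3 / r] undoes [r] and the 3 of [level_dist], giving lower slope 1. In the upper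
     bound, [n] is at most [vnorm (vsub x y) + 4], whence [12 = 3 * 4]. *)
  exists (fun x => vscal (3 / r) (f (pt x))).
  assert (H3r : 0 < 3 / r) by (apply Rdiv_lt_0_compat; lra).
  assert (Hall : forall x y, dom V a x -> dom V a y ->
    vnorm (vsub x y) - 2 <= vnorm (vsub (vscal (3 / r) (f (pt x))) (vscal (3 / r) (f (pt y))))
      <= 12 * Rabs C * (vnorm (vsub x y) + 1)).
  { intros x y Hx Hy. destruct (edge_connected (pt x) (pt y)) as [n0 Hn0].
    destruct (gdist_exists _ _ _ _ Hn0) as [n Hn]. specialize (Hf _ _ _ Hn) as [Hf1 Hf2].
    pose proof (level_dist _ _ _ _ _ _ Hn) as Hd1.
    pose proof (level_dist_up _ _ _ _ _ _ Hn) as [_ Hd2].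
    change (vnorm (vsub (q x) (q y)) <= 3 * INR n) in Hd1.
    change (INR n <= vnorm (vsub (q x) (q y)) + 2) in Hd2. pose proof (Hq x Hx) as Hqx. pose proof (Hq y Hy) as Hqy.
    pose proof (vnorm_le_add (vsub x y) (vsub x (q x)) (vsub (q x) y) ltac:(vec)).
    pose proof (vnorm_le_sub (vsub (q x) y) (vsub (q x) (q y)) (vsub y (q y)) ltac:(vec)).
    pose proof (vnorm_le_sub (vsub (q x) (q y)) (vsub x (q y)) (vsub x (q x)) ltac:(vec)).
    pose proof (vnorm_le_add (vsub x (q y)) (vsub x y) (vsub y (q y)) ltac:(vec)).
    replace (vsub (vscal _ _) _) with (vscal (3 / r) (vsub (f (pt x)) (f (pt y)))) by vec.
    rewrite vnorm_scal_pos by lra. pose proof (pos_INR n) as Hn0'. split.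
    - apply (Rmult_le_compat_l (3 / r)) in Hf1; [|lra].
      replace (3 / r * (r * INR n)) with (3 * INR n) in Hf1 by (field; lra). lra.
    - apply (Rmult_le_compat_l (3 / r)) in Hf2; [|lra].
      replace (3 / r * (r * C * INR n)) with (3 * (C * INR n)) in Hf2 by (field; lra).
      pose proof (Rle_abs C). pose proof (Rabs_pos C). pose proof (vnorm_pos (vsub x y)).
      assert (C * INR n <= Rabs C * INR n) by (apply Rmult_le_compat_r; lra).
      assert (Rabs C * INR n <= Rabs C * (4 * (vnorm (vsub x y) + 1)))
        by (apply Rmult_le_compat_l; lra). lra. }
  split; intros x y Hx Hy; now apply Hall.
Qed.

End Graph.

(** * Embedding the graph *)

(** An almost nearest point [x0] is found without an infimum: if none existed, the lower bound [rho]
    for the distance could be doubled forever. *)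
Lemma riesz {E : NormedSpace} (Y : E -> Prop) (w : E) : subspace Y -> complete Y -> ~ Y w ->
  exists a x0, 0 < a /\ Y x0 /\ vnorm (vscal a (vsub w x0)) <= 2 /\
    forall x, Y x -> 1 <= vnorm (vsub (vscal a (vsub w x0)) x).
Proof.
  intros HY Hc Hw. destruct (complete_dist_pos Y w Hc Hw) as (rho & Hrho & Hd).
  assert (Hex : exists s x0, 0 < s /\ Y x0 /\ vnorm (vsub w x0) <= 2 * s /\
            forall x, Y x -> s <= vnorm (vsub w x)).
  { apply NNPP. intros Hno.
    assert (Hn : forall n x, Y x -> 2 ^ n * rho <= vnorm (vsub w x)).
    { induction n as [|n IH]; intros x Hx; [specialize (Hd x Hx); cbn; lra|].
      apply Rnot_lt_le. intros Hlt. apply Hno. exists (2 ^ n * rho), x.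
      split; [apply Rmult_lt_0_compat; [apply pow_lt|]; lra|]. split; [easy|]. split; [|easy].
      cbn in Hlt. lra. }
    destruct (Pow_x_infinity 2 ltac:(rewrite Rabs_pos_eq; lra) (vnorm (vsub w vzero) / rho + 1))
      as [n Hpow].
    specialize (Hpow n (Nat.le_refl n)). rewrite Rabs_pos_eq in Hpow by (apply pow_le; lra).
    specialize (Hn n vzero ltac:(apply HY)).
    assert (H : (vnorm (vsub w vzero) / rho + 1) * rho <= 2 ^ n * rho)
      by (apply Rmult_le_compat_r; lra).
    replace ((vnorm (vsub w vzero) / rho + 1) * rho) with (vnorm (vsub w vzero) + rho) in H
      by (field; lra). lra. }
  destruct Hex as (s & x0 & Hs & Hx0 & Hle & Hge).
  assert (Hs' : 0 < / s) by now apply Rinv_0_lt_compat.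
  exists (/ s), x0. split; [easy|]. split; [easy|]. split.
  - rewrite vnorm_scal_pos by lra. apply (Rmult_le_reg_l s); [easy|].
    rewrite <- Rmult_assoc, Rinv_r by lra. lra.
  - intros x Hx.
    replace (vsub (vscal (/ s) (vsub w x0)) x) with (vscal (/ s) (vsub w (vadd x0 (vscal s x)))).
    + rewrite vnorm_scal_pos by lra. apply (Rmult_le_reg_l s); [easy|].
      rewrite <- Rmult_assoc, Rinv_r by lra.
      specialize (Hge (vadd x0 (vscal s x)) ltac:(apply HY; [easy|now apply HY])). lra.
    + assert (s <> 0) by lra. vec.
Qed.

(** * Transversality to a line *)

Section Transversal.
Context {E X : NormedSpace} (Y Z : E -> Prop) (HY : subspace Y) (HZ : subspace Z)
  (HYZ : forall x, Y x -> Z x) (z : E) (Hz : Z z) (Hz2 : vnorm z <= 2)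
  (Hz1 : forall x, Y x -> 1 <= vnorm (vsub z x))
  (T : E -> X) (K : R) (HK : 1 <= K) (HT : linear_on Z T)
  (HTK : forall x, Z x -> vnorm x <= vnorm (T x) <= K * vnorm x)
  (e : X) (He : vnorm e = 1).

Lemma norm_add_z x a : Y x ->
  Rabs a <= vnorm (vadd x (vscal a z)) /\ vnorm x <= 3 * vnorm (vadd x (vscal a z)).
Proof.
  intros Hx. assert (Ha : Rabs a <= vnorm (vadd x (vscal a z))).
  { destruct (Req_dec a 0) as [->|Ha]; [rewrite Rabs_R0; apply vnorm_pos|].
    replace (vadd x (vscal a z)) with (vscal a (vsub z (vscal (- / a) x))) by vec.
    rewrite vnorm_scal. specialize (Hz1 (vscal (- / a) x) ltac:(now apply HY)).
    pose proof (Rabs_pos a). nra. }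
  split; [easy|].
  pose proof (vnorm_le_sub x (vadd x (vscal a z)) (vscal a z) ltac:(vec)) as H.
  rewrite vnorm_scal in H. pose proof (Rabs_pos a). pose proof (vnorm_pos z). nra.
Qed.

Lemma linear_sub x y : Z x -> Z y -> T (vsub x y) = vsub (T x) (T y).
Proof.
  intros Hx Hy. unfold vsub. rewrite (proj1 HT) by (try apply subspace_opp; easy).
  rewrite !vopp_scal. now rewrite (proj2 HT).
Qed.

(** If the line of [e] is close to [T Y], say [e] close to [T x0], then bending [Y] into the cone
    [x + |x| z] moves its image away from this line. *)
Lemma exists_transversal : exists g : E -> X, g vzero = vzero /\
  (forall x y, Y x -> Y y ->
     vnorm (vsub x y) <= 3 * vnorm (vsub (g x) (g y)) /\
     vnorm (vsub (g x) (g y)) <= 3 * K * vnorm (vsub x y)) /\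
  (forall s x, Y x -> Rabs s + vnorm x <= 33 * K * vnorm (vadd (vscal s e) (g x))).
Proof.
  (* Small enough that, in the bent case, replacing [e] by [T x0] costs at most [5/16] of [vnorm m];
     in the other case it gives directly [Rabs s <= 16 * K * N]. *)
  set (del := / (16 * K)).
  assert (Hdel : del * (16 * K) = 1) by (unfold del; field; lra).
  assert (Hdel0 : 0 < del) by (apply Rinv_0_lt_compat; lra).
  assert (HT0 : T vzero = vzero).
  { replace (@vzero E) with (vscal 0 (@vzero E)) by vec. rewrite (proj2 HT) by apply HZ. vec. }
  destruct (classic (exists s x, Y x /\ vnorm (vadd (vscal s e) (T x)) < del * Rabs s))
    as [(s0 & x1 & Hx1 & Hlt)|Hno].
  - assert (Hs0 : s0 <> 0).
    { intros ->. rewrite Rabs_R0, Rmult_0_r in Hlt. pose proof (vnorm_pos (vadd (vscal 0 e) (T x1))). lra. }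
    set (x0 := vscal (- / s0) x1). assert (Hx0 : Y x0) by now apply HY.
    assert (Hclose : vnorm (vsub e (T x0)) <= del).
    { unfold x0. rewrite (proj2 HT) by auto.
      replace (vsub e (vscal (- / s0) (T x1))) with (vscal (/ s0) (vadd (vscal s0 e) (T x1))) by vec.
      rewrite vnorm_scal, Rabs_inv. pose proof (Rabs_pos_lt s0 Hs0).
      apply (Rmult_le_reg_l (Rabs s0)); [easy|]. rewrite <- Rmult_assoc, Rinv_r by lra. lra. }
    clearbody x0. clear x1 Hx1 Hlt s0 Hs0.
    assert (HZc : forall x, Y x -> Z (vadd x (vscal (vnorm x) z)))
      by (intros x Hx; apply HZ; [auto|now apply HZ]).
    exists (fun x => T (vadd x (vscal (vnorm x) z))). split; [|split].
    + rewrite vnorm_vzero. replace (vadd vzero (vscal 0 z)) with (@vzero E) by vec. easy.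
    + intros x y Hx Hy. rewrite <- linear_sub by auto.
      set (a := vnorm x - vnorm y).
      replace (vsub (vadd x _) _) with (vadd (vsub x y) (vscal a z)) by (unfold a; vec).
      destruct (norm_add_z (vsub x y) a ltac:(now apply subspace_sub)) as [H1 H2].
      assert (HZa : Z (vadd (vsub x y) (vscal a z)))
        by (apply HZ; [apply HYZ; now apply subspace_sub|now apply HZ]).
      destruct (HTK _ HZa) as [H3 H4]. split; [lra|].
      assert (Ha : Rabs a <= vnorm (vsub x y)).
      { unfold a. apply Rabs_le.
        pose proof (vnorm_le_add x (vsub x y) y ltac:(vec)).
        pose proof (vnorm_le_sub y x (vsub x y) ltac:(vec)). lra. }
      pose proof (vnorm_triangle _ (vsub x y) (vscal a z)) as H5. rewrite vnorm_scal in H5.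
      pose proof (Rabs_pos a). pose proof (vnorm_pos z).
      assert (Rabs a * vnorm z <= vnorm (vsub x y) * 2) by (apply Rmult_le_compat; lra).
      assert (K * vnorm (vadd (vsub x y) (vscal a z)) <= K * (3 * vnorm (vsub x y)))
        by (apply Rmult_le_compat_l; lra). lra.
    + intros s x Hx. set (y := vadd (vscal s x0) x).
      assert (Hy : Y y) by (apply HY; [now apply HY|easy]).
      (* If [e] were equal to [T x0], the vector to be estimated would be [T m]. The component along
         [z] makes [vnorm m] dominate [vnorm x], and then also [s x0 = y - x]. *)
      set (m := vadd y (vscal (vnorm x) z)).
      assert (Hm : Z m) by (apply HZ; [auto|now apply HZ]).
      assert (HTm : T m = vadd (vscal s (T x0)) (T (vadd x (vscal (vnorm x) z)))).
      { rewrite <- (proj2 HT), <- (proj1 HT) by (solve [auto] || (apply HZ; auto)). f_equal. unfold m, y. vec. }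
      destruct (norm_add_z y (vnorm x) Hy) as [H1 H2]. fold m in H1, H2.
      rewrite Rabs_pos_eq in H1 by apply vnorm_pos.
      destruct (HTK m Hm) as [H3 _]. destruct (HTK x0 ltac:(auto)) as [_ H4].
      set (N := vnorm (vadd (vscal s e) _)).
      assert (H5 : vnorm (T m) <= N + Rabs s * del).
      { pose proof (vnorm_le_sub (T m) (vadd (vscal s e) (T (vadd x (vscal (vnorm x) z))))
          (vscal s (vsub e (T x0))) ltac:(rewrite HTm; vec)) as H. fold N in H.
        rewrite vnorm_scal in H. pose proof (Rabs_pos s). nra. }
      (* [T x0] is close to a unit vector, so [x0] is not small and a bound on [s x0] bounds [s]. *)
      assert (H6 : 1 <= K * vnorm x0 + del).
      { pose proof (vnorm_le_add e (T x0) (vsub e (T x0)) ltac:(vec)). lra. }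
      assert (H7 : Rabs s * vnorm x0 <= 4 * vnorm m).
      { rewrite <- vnorm_scal. pose proof (vnorm_le_sub (vscal s x0) y x ltac:(unfold y; vec)). lra. }
      assert (H8 : Rabs s <= 5 * K * vnorm m).
      { pose proof (Rabs_pos s). assert (Rabs s * (K * vnorm x0) <= K * (4 * vnorm m)) by nra.
        assert (Rabs s * (1 - del) <= K * (4 * vnorm m)) by nra.
        assert (del <= / 16) by nra. nra. }
      assert (H9 : Rabs s * del <= 5 / 16 * vnorm m).
      { apply (Rmult_le_compat_r del) in H8; [|lra].
        replace (5 * K * vnorm m * del) with (5 / 16 * (del * (16 * K)) * vnorm m) in H8 by field.
        rewrite Hdel in H8. lra. }
      pose proof (vnorm_pos x). pose proof (vnorm_pos m).
      assert (Hm2 : vnorm m <= 2 * N) by lra.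
      assert (K * vnorm m <= K * (2 * N)) by (apply Rmult_le_compat_l; lra).
      assert (1 * N <= K * N) by (apply Rmult_le_compat_r; lra). lra.
  - exists T. split; [easy|]. split.
    + intros x y Hx Hy. rewrite <- linear_sub by auto.
      destruct (HTK (vsub x y) ltac:(apply HYZ; now apply subspace_sub)) as [H1 H2].
      pose proof (vnorm_pos (vsub x y)). split; [lra|]. nra.
    + intros s x Hx. set (N := vnorm (vadd (vscal s e) (T x))).
      assert (H1 : del * Rabs s <= N).
      { apply Rnot_lt_le. intros H. apply Hno. now exists s, x. }
      assert (H2 : Rabs s <= 16 * K * N).
      { apply (Rmult_le_compat_l (16 * K)) in H1; [|lra].
        replace (16 * K * (del * Rabs s)) with (del * (16 * K) * Rabs s) in H1 by ring.
        rewrite Hdel in H1. lra. }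
      destruct (HTK x ltac:(auto)) as [H3 _].
      pose proof (vnorm_le_sub (T x) (vadd (vscal s e) (T x)) (vscal s e) ltac:(vec)) as H4.
      fold N in H4. rewrite vnorm_scal, He in H4.
      assert (0 <= N) by apply vnorm_pos.
      assert (1 * N <= K * N) by (apply Rmult_le_compat_r; lra). lra.
Qed.

End Transversal.

(** Within a level [g t] is bilipschitz. Between a ball and a point of the ray transversality
    applies, however close the levels. Between two balls the radii are dominated by the gap of the
    levels. *)
Lemma transversal_bilip {E X : NormedSpace} (Y : nat -> E -> Prop) (rad : nat -> nat)
  (M : nat -> E -> Prop) (HY : forall t, subspace (Y t)) (HM0 : forall t, M t vzero)
  (HM : forall t, separated_net (dom (Y t) (INR (rad t))) (M t))
  (Hrad : forall t s, t <> s ->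
     rad t = O \/ rad s = O \/ INR (rad t) + INR (rad s) <= Rabs (INR t - INR s))
  (e : X) (He : vnorm e = 1) (K : R) (HK : 1 <= K) (g : nat -> E -> X)
  (Hg0 : forall t, g t vzero = vzero)
  (Hg : forall t x y, Y t x -> Y t y ->
     vnorm (vsub x y) <= 3 * vnorm (vsub (g t x) (g t y)) /\
     vnorm (vsub (g t x) (g t y)) <= 3 * K * vnorm (vsub x y))
  (Hge : forall t s x, Y t x -> Rabs s + vnorm x <= 33 * K * vnorm (vadd (vscal s e) (g t x))) :
  bilip_embeds (edge M) X.
Proof.
  (* For two balls at levels with gap [De], the images deviate from the line of [e] by at most
     [3 * K * De] in total, so a separation of at least [De] remains. *)
  set (A := 3 * K + 1).
  set (f := fun u : vertex M => vadd (vscal (A * INR (level M u)) e) (g (level M u) (point M u))).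
  assert (Hin : forall t x, M t x -> Y t x /\ vnorm x <= INR (rad t)) by (intros t; apply HM).
  assert (Hf1 : forall u v, edge M u v -> vnorm (vsub (f u) (f v)) <= 9 * K + 1).
  { intros u v Huv. destruct (vertex_mk M u) as (t & x & Hx & ->).
    destruct (vertex_mk M v) as (s & y & Hy & ->). unfold f. cbn.
    destruct Huv as [(H1 & H2 & H3)|(H1 & H2 & H3)]; cbn in *.
    - subst s. replace (vsub _ _) with (vsub (g t x) (g t y)) by vec.
      destruct (Hg t x y ltac:(now apply Hin) ltac:(now apply Hin)) as [_ H]. nra.
    - subst x y. rewrite !Hg0.
      replace (vsub _ _) with (vscal (A * (INR t - INR s)) e) by vec.
      rewrite vnorm_scal, He, Rabs_mult, (Rabs_pos_eq A) by (unfold A; lra).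
      assert (Rabs (INR t - INR s) = 1).
      { destruct H3 as [-> | ->]; rewrite S_INR; [rewrite Rabs_pos_eq|rewrite Rabs_left]; lra. }
      unfold A. nra. }
  assert (Hf2 : forall u v n, gdist (edge M) u v n -> INR n <= 99 * K * vnorm (vsub (f u) (f v))).
  { intros u v n Hn. destruct (vertex_mk M u) as (t & x & Hx & ->).
    destruct (vertex_mk M v) as (s & y & Hy & ->).
    destruct (Hin t x Hx) as [HYx Hxr]. destruct (Hin s y Hy) as [HYy Hyr].
    pose proof (vnorm_pos x) as Hx0. pose proof (vnorm_pos y) as Hy0.
    pose proof (vnorm_pos (vsub (f (mk M t x Hx)) (f (mk M s y Hy)))) as HN0.
    destruct (Nat.eq_dec t s) as [Hts|Hts].
    - subst s. apply (level_dist_up Y rad M HY HM) in Hn as [Hn _].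
      destruct (Hg t x y HYx HYy) as [H _].
      replace (vsub (f _) _) with (vsub (g t x) (g t y)) in * by (unfold f; cbn; vec). nra.
    - apply (far_dist Y rad M HY HM0 HM) in Hn.
      assert (Hfs : vsub (f (mk M t x Hx)) (f (mk M s y Hy)) =
        vsub (vadd (vscal (A * (INR t - INR s)) e) (g t x)) (g s y)) by (unfold f; cbn; vec).
      rewrite Hfs in *. clear Hfs. clear f Hf1.
      assert (HgN : forall t x, Y t x -> vnorm (g t x) <= 3 * K * vnorm x).
      { intros t' x' Hx'. destruct (Hg t' x' vzero Hx' ltac:(apply HY)) as [_ H].
        rewrite Hg0 in H. replace (vsub x' vzero) with x' in H by vec.
        now replace (vsub (g t' x') vzero) with (g t' x') in H by vec. }
      set (De := Rabs (INR t - INR s)) in *.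
      assert (HDe : 0 <= De) by apply Rabs_pos.
      assert (HAs : forall c, Rabs (A * c) = A * Rabs c)
        by (intros c; rewrite Rabs_mult, (Rabs_pos_eq A); unfold A; lra).
      destruct (Hrad t s Hts) as [H0|[H0|H0]].
      + rewrite H0 in Hxr. cbn in Hxr.
        assert (Hxz : x = vzero) by (apply vnorm_zero; lra). subst x.
        rewrite Hg0, vnorm_sub_sym in *.
        replace (vsub (g s y) _) with (vadd (vscal (A * (INR s - INR t)) e) (g s y)) in * by vec.
        pose proof (Hge s (A * (INR s - INR t)) y HYy) as H. rewrite HAs, Rabs_minus_sym in H.
        fold De in H. unfold A in H at 1. rewrite vnorm_vzero in Hn. nra.
      + rewrite H0 in Hyr. cbn in Hyr.
        assert (Hyz : y = vzero) by (apply vnorm_zero; lra). subst y.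
        rewrite Hg0 in *.
        replace (vsub (vadd (vscal (A * (INR t - INR s)) e) (g t x)) vzero)
          with (vadd (vscal (A * (INR t - INR s)) e) (g t x)) in * by vec.
        pose proof (Hge t (A * (INR t - INR s)) x HYx) as H. rewrite HAs in H.
        fold De in H. unfold A in H at 1. rewrite vnorm_vzero in Hn. nra.
      + pose proof (HgN t x HYx) as H1. pose proof (HgN s y HYy) as H2.
        set (N := vnorm (vsub (vadd (vscal (A * (INR t - INR s)) e) (g t x)) (g s y))) in *.
        fold De in H0.
        pose proof (vnorm_le_sub (vscal (A * (INR t - INR s)) e)
          (vadd (vscal (A * (INR t - INR s)) e) (g t x)) (g t x) ltac:(vec)) as H3.
        pose proof (vnorm_le_add (vadd (vscal (A * (INR t - INR s)) e) (g t x))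
          (vsub (vadd (vscal (A * (INR t - INR s)) e) (g t x)) (g s y)) (g s y) ltac:(vec)) as H4.
        fold N in H4. rewrite vnorm_scal, He, HAs in H3. fold De in H3.
        assert (3 * K * (vnorm x + vnorm y) <= 3 * K * De) by (apply Rmult_le_compat_l; lra).
        assert (De <= N) by (unfold A in H3 at 1; lra).
        assert (4 * N <= 99 * K * N) by (apply Rmult_le_compat_r; lra). lra. }
  assert (Hr : 0 < / (99 * K)) by (apply Rinv_0_lt_compat; lra).
  exists f, (/ (99 * K)), ((9 * K + 1) * (99 * K)). split; [easy|].
  intros u v n Hn. split.
  - apply (Rmult_le_reg_l (99 * K)); [lra|]. rewrite <- Rmult_assoc, Rinv_r by lra.
    rewrite Rmult_1_l. now apply Hf2.
  - replace (/ (99 * K) * ((9 * K + 1) * (99 * K))) with (9 * K + 1) by (field; lra).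
    apply (walk_lipschitz (edge M)); [easy|apply Hn].
Qed.

(** The ball of radius [q] sits at position [q * q] of the ray; the other positions carry
    a single point. *)
Definition square_radius (t : nat) : nat :=
  if Nat.eqb (Nat.sqrt t * Nat.sqrt t) t then Nat.sqrt t else O.

Lemma square_radius_square q : square_radius (q * q) = q.
Proof. unfold square_radius. now rewrite Nat.sqrt_square, Nat.eqb_refl. Qed.

Lemma square_radius_separated t s : t <> s ->
  square_radius t = O \/ square_radius s = O \/
  INR (square_radius t) + INR (square_radius s) <= Rabs (INR t - INR s).
Proof.
  intros H. unfold square_radius.
  destruct (Nat.eqb_spec (Nat.sqrt t * Nat.sqrt t) t) as [Ht|]; [|now left].
  destruct (Nat.eqb_spec (Nat.sqrt s * Nat.sqrt s) s) as [Hs|]; [|now right; left].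
  right; right. rewrite <- plus_INR.
  assert (Hw : forall a b p q : nat, (a * a = p)%nat -> (b * b = q)%nat -> (p < q)%nat ->
            INR (a + b) <= INR q - INR p).
  { intros a b p q <- <- Hlt. rewrite <- minus_INR by lia. apply le_INR.
    assert (a < b)%nat by nia. nia. }
  destruct (Nat.lt_ge_cases t s) as [Hlt|Hge].
  - rewrite Rabs_minus_sym. eapply Rle_trans; [|apply Rle_abs]. now apply Hw.
  - eapply Rle_trans; [|apply Rle_abs]. rewrite Nat.add_comm. apply Hw; try easy. lia.
Qed.

Theorem theorem3p1 (E : NormedSpace) (Xs : nat -> E -> Prop) (d : nat -> nat)
  (hdim : forall n, has_dim (Xs n) (d n))
  (hnest : forall n x, Xs n x -> Xs (S n) x)
  (hinf : forall M : nat, exists N : nat, forall n, (N <= n)%nat -> (M <= d n)%nat) :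
  exists (V : Type) (adj : V -> V -> Prop),
    simple_graph adj /\ connected adj /\ infinite_type V /\
    forall X : NormedSpace, banach X ->
      (bilip_embeds adj X <-> unif_iso_embeds E Xs X).
Proof.
  assert (Hbasis : forall n, exists v, indep (d n) v /\ forall x, Xs n x <-> span (d n) v x)
    by (intros n; now apply has_dim_basis).
  (* Extensionality identifies [Xs n] with a span, so any property of spans transfers. *)
  assert (Hspan : forall n (P : (E -> Prop) -> Prop), (forall v, indep (d n) v -> P (span (d n) v)) -> P (Xs n)).
  { intros n P HP. destruct (Hbasis n) as (v & Hi & Hv).
    replace (Xs n) with (span (d n) v); [auto|].
    apply functional_extensionality. intros x. now apply propositional_extensionality. }
  assert (HY : forall n, subspace (Xs n)) by (intros n; apply Hspan; intros; apply span_subspace).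
  assert (HYc : forall n, complete (Xs n))
    by (intros n; apply Hspan; intros v Hv; now apply fin_dim_coord_complete).
  assert (Hmono : forall n m x, (n <= m)%nat -> Xs n x -> Xs m x)
    by (intros n m x Hnm; induction Hnm; auto).
  assert (HMex : forall t, exists M, M vzero /\ separated_net (dom (Xs t) (INR (square_radius t))) M).
  { intros t. apply (Hspan t (fun V => exists M, M vzero /\ separated_net (dom V (INR (square_radius t))) M)).
    intros v Hv. destruct (fin_dim_coord_complete _ _ Hv) as [(k & Hk & Hc) _].
    apply (exists_separated_net (d t) v k); [easy|apply pos_INR|easy]. }
  set (M t := proj1_sig (constructive_indefinite_description _ (HMex t))).
  assert (HM0 : forall t, M t vzero)
    by (intros t; apply (proj2_sig (constructive_indefinite_description _ (HMex t)))).
  assert (HM : forall t, separated_net (dom (Xs t) (INR (square_radius t))) (M t))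
    by (intros t; apply (proj2_sig (constructive_indefinite_description _ (HMex t)))).
  clearbody M.
  exists (vertex M), (edge M). split; [apply edge_simple|].
  split; [now apply (edge_connected Xs square_radius M HY HM0 HM)|].
  split; [now apply vertex_infinite|]. intros X _. split.
  (* The quotient of the slopes [3 * (12 * Rabs C + 1)] and [1/2]; the added 1 provides the
     condition [1 <= C] of [exists_linear_map]. *)
  - intros (f & r & C & Hr & Hf). exists (6 * (12 * Rabs C + 1)). intros n.
    destruct (Hbasis n) as (v & Hi & Hv).
    destruct (fin_dim_coord_complete _ _ Hi) as [(k & Hk & Hc) _].
    pose proof (Rabs_pos C) as HC.
    destruct (exists_linear_map (X := X) (Xs n) v (d n) k (12 * Rabs C + 1) 2 Hv Hk Hc ltac:(lra))
      as (T & HT & HTb).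
    + intros a. destruct (bilip_coarse Xs square_radius M HY HM0 HM X (Xs n) f r C Hr Hf) with (a := a)
        as (G & HG1 & HG2).
      (* Position [p * p] carries a ball of radius [p >= b], in a space containing [Xs n] since
         [n <= p * p]. *)
      * intros b. destruct (nat_above b) as (q & _ & Hq). set (p := (q + n)%nat).
        exists (p * p)%nat. rewrite square_radius_square. split.
        -- unfold p. rewrite plus_INR. pose proof (pos_INR n). lra.
        -- intros x. apply Hmono. unfold p. nia.
      * exists G. split; [|easy]. intros x y Hx Hy. specialize (HG1 x y Hx Hy).
        pose proof (vnorm_pos (vsub x y)). nra.
    + exists T, (/ 2). split; [easy|]. split; [lra|]. intros x Hx. specialize (HTb x Hx). lra.
  - intros [K0 HT]. set (K := Rmax 1 K0). assert (HK : 1 <= K) by apply Rmax_l.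
    assert (HTn : forall n, exists T : E -> X, linear_on (Xs n) T /\
              forall x, Xs n x -> vnorm x <= vnorm (T x) <= K * vnorm x).
    { intros n. destruct (HT n) as (T & c & [HT1 HT2] & Hc & HTc).
      assert (Hc' : 0 < / c) by now apply Rinv_0_lt_compat.
      exists (fun x => vscal (/ c) (T x)). split; [split|].
      - intros x y Hx Hy. rewrite HT1 by easy. vec.
      - intros a x Hx. rewrite HT2 by easy. vec.
      - intros x Hx. destruct (HTc x Hx) as [H1 H2]. rewrite vnorm_scal_pos by lra.
        split; apply (Rmult_le_reg_l c); try easy; rewrite <- Rmult_assoc, Rinv_r, Rmult_1_l by lra; [easy|].
        pose proof (Rmax_r 1 K0) as HK0. fold K in HK0. pose proof (vnorm_pos x).
        assert (c * K0 * vnorm x <= c * K * vnorm x); [|lra].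
        apply Rmult_le_compat_r; [easy|]. apply Rmult_le_compat_l; lra. }
    assert (He : exists e : X, vnorm e = 1).
    { destruct (hinf 1%nat) as [N HN]. specialize (HN N (Nat.le_refl N)).
      destruct (Hbasis N) as (v & Hi & Hv). destruct (HTn N) as (T & _ & HTb).
      assert (Hv0 : v O <> vzero).
      { intros H0. assert (H1 : (if Nat.eqb 0 0 then 1 else 0) = 0); [|cbn in H1; lra].
        apply (Hi (fun i => if Nat.eqb i 0 then 1 else 0)); [|lia]. now rewrite lc_delta by lia. }
      assert (HX : Xs N (v O)) by (apply Hv; eexists; symmetry; apply lc_delta; lia).
      pose proof (vnorm_pos_lt _ Hv0). specialize (HTb _ HX).
      exists (vscal (/ vnorm (T (v O))) (T (v O))).
      rewrite vnorm_scal_pos by (apply Rlt_le, Rinv_0_lt_compat; lra). field. lra. }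
    destruct He as [e He].
    assert (Hg : forall t, exists g : E -> X, g vzero = vzero /\
      (forall x y, Xs t x -> Xs t y ->
         vnorm (vsub x y) <= 3 * vnorm (vsub (g x) (g y)) /\
         vnorm (vsub (g x) (g y)) <= 3 * K * vnorm (vsub x y)) /\
      (forall s x, Xs t x -> Rabs s + vnorm x <= 33 * K * vnorm (vadd (vscal s e) (g x)))).
    (* [Xs p] contains [Xs t] and has larger dimension; a vector of it outside [Xs t] supplies the
       direction in which to bend. *)
    { intros t. destruct (hinf (S (d t))) as [N HN]. set (p := (N + t)%nat).
      specialize (HN p ltac:(lia)).
      assert (Hw : exists w, Xs p w /\ ~ Xs t w).
      { apply NNPP. intros Hno. destruct (Hbasis p) as (v & Hi & Hv). destruct (Hbasis t) as (v' & _ & Hv').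
        assert (Hle : (d p <= d t)%nat); [|lia]. apply (indep_span_le (d t) v' (d p) v Hi).
        intros i Hid. apply Hv'. apply NNPP. intros Hn. apply Hno. exists (v i). split; [|easy].
        apply Hv. eexists. symmetry. now apply lc_delta. }
      destruct Hw as (w & Hwp & Hwt).
      destruct (riesz (Xs t) w (HY t) (HYc t) Hwt) as (a & x0 & Ha & Hx0 & Hz2 & Hz1).
      destruct (HTn p) as (T & HTl & HTb).
      assert (Hsub : forall x, Xs t x -> Xs p x) by (intros x; apply Hmono; unfold p; lia).
      apply (exists_transversal (Xs t) (Xs p) (HY t) (HY p) Hsub (vscal a (vsub w x0))
        ltac:(apply HY; apply subspace_sub; auto) Hz2 Hz1 T K HK HTl HTb e He). }
    set (g t := proj1_sig (constructive_indefinite_description _ (Hg t))).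
    assert (Hgs : forall t, _) by (intros t; exact (proj2_sig (constructive_indefinite_description _ (Hg t)))).
    apply (transversal_bilip Xs square_radius M HY HM0 HM square_radius_separated e He K HK g).
    + intros t. apply (Hgs t).
    + intros t. apply (Hgs t).
    + intros t. apply (Hgs t).
Qed.
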